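(* Under Assumption 1 (stated in the context), the mixed cost $J_{\mathrm{mix}}$ is real analytic on $\mathcal{K}_\beta$.
   Context: Let $A\in\mathbb{R}^{n\times n}$, $B\in\mathbb{R}^{n\times m}$, $B_w\in\mathbb{R}^{n\times n}$, $W:=B_wB_w^{\mathsf T}$. Let $Q_2\succeq0$, $R_2\succ0$, $Q_\infty\succ0$, $R_\infty\succ0$ be symmetric weight matrices and $\beta>0$. For $K\in\mathbb{R}^{m\times n}$ write $A_K:=A+BK$, $S_K:=Q_\infty+K^{\mathsf T}R_\infty K$. Let $\mathcal{K}:=\{K: A_K \text{ Hurwitz}\}$. For $K\in\mathcal{K}$ let $\mathbf{T}_\infty(K)(s)=\begin{bmatrix}Q_\infty^{1/2}\\ R_\infty^{1/2}K\end{bmatrix}(sI-A_K)^{-1}B_w$ and $\mathcal{K}_\beta:=\{K\in\mathcal{K}:\|\mathbf{T}_\infty(K)\|_{\mathcal{H}_\infty}<\beta\}$. For $K\in\mathcal{K}_\beta$ the Riccati equation $A_KX+XA_K^{\mathsf T}+\beta^{-2}XS_KX+W=0$ has a unique stabilizing solution $X_K\succeq0$ (i.e. $A_K+\beta^{-2}X_KS_K$ Hurwitz), and $J_{\mathrm{mix}}(K):=\operatorname{tr}((Q_2+K^{\mathsf T}R_2K)X_K)$. Assumption 1: $(A,B)$ stabilizable, $(Q_2^{1/2},A)$ detectable, and $\beta>\inf_{K\in\mathcal{K}}\|\mathbf{T}_\infty(K)\|_{\mathcal{H}_\infty}$. *)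

(* Defs.v *)
From HB Require Import structures.
From mathcomp Require Import all_boot all_order all_algebra.
From mathcomp Require Import all_classical all_reals all_analysis.
From mathcomp Require Import complex.
Set Implicit Arguments. Unset Strict Implicit. Unset Printing Implicit Defensive.
Import Order.TTheory GRing.Theory Num.Theory.
Import numFieldNormedType.Exports.
Local Open Scope classical_set_scope.
Local Open Scope ring_scope.

Section Defs.
Variable R : realType.

Definition CR (x : R) : R[i] := Complex x 0.

Definition hurwitz n (A : 'M[R]_n) : Prop :=
  forall z : R[i], root (map_poly CR (char_poly A)) z -> complex.Re z < 0.

Definition psd n (X : 'M[R]_n) : Prop :=
  X^T = X /\ forall v : 'cV[R]_n, 0 <= (v^T *m X *m v) 0 0.
Definition pd n (X : 'M[R]_n) : Prop :=
  X^T = X /\ forall v : 'cV[R]_n, v != 0 -> 0 < (v^T *m X *m v) 0 0.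

Definition sqrtm n (Q : 'M[R]_n) : 'M[R]_n :=
  xget 0 [set C | psd C /\ C *m C = Q].

Definition cvnorm k (v : 'cV[R[i]]_k) : R :=
  Num.sqrt (\sum_(i < k) (complex.Re (v i 0) ^+ 2 + complex.Im (v i 0) ^+ 2)).
Definition opnorm p q (M : 'M[R[i]]_(p, q)) : R :=
  sup [set cvnorm (M *m v) | v in [set v : 'cV[R[i]]_q | cvnorm v <= 1]].

Definition AK n m (A : 'M[R]_n) (B : 'M[R]_(n, m)) (K : 'M[R]_(m, n)) : 'M[R]_n :=
  A + B *m K.
Definition SK n m (Qi : 'M[R]_n) (Ri : 'M[R]_m) (K : 'M[R]_(m, n)) : 'M[R]_n :=
  Qi + K^T *m Ri *m K.

Definition Tinf n m (A : 'M[R]_n) (B : 'M[R]_(n, m)) (Bw : 'M[R]_n)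
    (Qi : 'M[R]_n) (Ri : 'M[R]_m) (K : 'M[R]_(m, n)) (w : R) : 'M[R[i]]_(n + m, n) :=
  map_mx CR (col_mx (sqrtm Qi) (sqrtm Ri *m K))
  *m invmx ((Complex 0 w)%:M - map_mx CR (AK A B K))
  *m map_mx CR Bw.

Definition hinf_norm n m (A : 'M[R]_n) (B : 'M[R]_(n, m)) (Bw : 'M[R]_n)
    (Qi : 'M[R]_n) (Ri : 'M[R]_m) (K : 'M[R]_(m, n)) : R :=
  sup [set opnorm (Tinf A B Bw Qi Ri K w) | w in [set: R]].

Definition Kstab n m (A : 'M[R]_n) (B : 'M[R]_(n, m)) : set 'M[R]_(m, n) :=
  [set K | hurwitz (AK A B K)].

Definition Kbeta n m (A : 'M[R]_n) (B : 'M[R]_(n, m)) (Bw : 'M[R]_n)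
    (Qi : 'M[R]_n) (Ri : 'M[R]_m) (beta : R) : set 'M[R]_(m, n) :=
  [set K | hurwitz (AK A B K) /\ hinf_norm A B Bw Qi Ri K < beta].

Definition stab_riccati_sol n m (A : 'M[R]_n) (B : 'M[R]_(n, m)) (Bw : 'M[R]_n)
    (Qi : 'M[R]_n) (Ri : 'M[R]_m) (beta : R) (K : 'M[R]_(m, n)) (X : 'M[R]_n) : Prop :=
  psd X /\
  AK A B K *m X + X *m (AK A B K)^T + beta ^- 2 *: (X *m SK Qi Ri K *m X)
    + Bw *m Bw^T = 0 /\
  hurwitz (AK A B K + beta ^- 2 *: (X *m SK Qi Ri K)).

(* X_K : the (unique, for K in K_beta) stabilizing solution *)
Definition XK n m (A : 'M[R]_n) (B : 'M[R]_(n, m)) (Bw : 'M[R]_n)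
    (Qi : 'M[R]_n) (Ri : 'M[R]_m) (beta : R) (K : 'M[R]_(m, n)) : 'M[R]_n :=
  xget 0 [set X | stab_riccati_sol A B Bw Qi Ri beta K X].

Definition Jmix n m (A : 'M[R]_n) (B : 'M[R]_(n, m)) (Bw : 'M[R]_n)
    (Q2 : 'M[R]_n) (R2 : 'M[R]_m) (Qi : 'M[R]_n) (Ri : 'M[R]_m) (beta : R)
    (K : 'M[R]_(m, n)) : R :=
  \tr ((Q2 + K^T *m R2 *m K) *m XK A B Bw Qi Ri beta K).

Definition stabilizable n m (A : 'M[R]_n) (B : 'M[R]_(n, m)) : Prop :=
  exists K : 'M[R]_(m, n), hurwitz (A + B *m K).
Definition detectable n p (C : 'M[R]_(p, n)) (A : 'M[R]_n) : Prop :=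
  exists L : 'M[R]_(n, p), hurwitz (A + L *m C).

Definition psum m n (c : {ffun 'I_m * 'I_n -> nat} -> R) (K0 K : 'M[R]_(m, n))
    (N : nat) : R :=
  \sum_(a : {ffun 'I_m * 'I_n -> 'I_N})
     c [ffun ij => nat_of_ord (a ij)] *
     \prod_(ij : 'I_m * 'I_n) (K - K0) ij.1 ij.2 ^+ a ij.
Definition pabssum m n (c : {ffun 'I_m * 'I_n -> nat} -> R) (K0 K : 'M[R]_(m, n))
    (N : nat) : R :=
  \sum_(a : {ffun 'I_m * 'I_n -> 'I_N})
     `| c [ffun ij => nat_of_ord (a ij)] *
        \prod_(ij : 'I_m * 'I_n) (K - K0) ij.1 ij.2 ^+ a ij |.

Definition real_analytic_on m n (S : set 'M[R]_(m, n)) (f : 'M[R]_(m, n) -> R) : Prop :=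
  forall K0, S K0 ->
  exists r : R, 0 < r /\
  exists c : {ffun 'I_m * 'I_n -> nat} -> R,
  forall K, S K -> `|K - K0| < r ->
    (exists M : R, forall N, pabssum c K0 K N <= M) /\
    (psum c K0 K @ \oo --> f K).

End Defs.

(* Main.v *)
Require Import Defs.
From HB Require Import structures.
From mathcomp Require Import all_boot all_order all_algebra.
From mathcomp Require Import all_classical all_reals all_analysis.
From mathcomp Require Import complex ring lra.

(* A stabilizing solution X of the Riccati equation is unique, because the difference of two
   solutions satisfies a Sylvester equation with Hurwitz coefficients. Near a K0 that admits one,
   the increments of (K, X, K X, K^T Ri K X, K^T R2 K X) satisfy a quadratic fixed-point system
   y = a(k) + Q(y, y), whose linear part was inverted by the Lyapunov operator of the stabilized
   matrix. Its Picard iteration gives a power series with a geometric majorant, and the resulting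
   X is symmetric by uniqueness, psd by Lyapunov's theorem and stabilizing by openness, so it is
   X_K.

   The bounded real lemma is not needed: the set of K that admit a stabilizing solution is
   relatively closed in K_beta, so on the rest of K_beta the cost is locally the default value 0.
   For closedness, X S_K X >= c X^2 bounds X along a convergent sequence of gains. A limit point
   solves the equation and leaves the spectrum of A_K + beta^-2 X S_K in the closed left
   half-plane; an eigenvalue i w would yield an input on which the transfer matrix at frequency -w
   has gain at least beta. *)
Set Implicit Arguments. Unset Strict Implicit. Unset Printing Implicit Defensive.
Import Order.TTheory GRing.Theory Num.Theory.
Import numFieldNormedType.Exports.
Local Open Scope classical_set_scope.
Local Open Scope ring_scope.

(** * Quadratic forms and complex pairs *)

Section QuadraticForms.
Variable R : realType.

(** In [(K, X)] the term [X S_K X] has degree four. With [K X] and [K^T Ri K X] as further unknowns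
    every term has degree at most two, and [K^T R2 K X] makes the cost affine in the unknowns. A
    bilinear equation has a scalar majorant: if [l] bounds the linear part and [q] the bilinear
    part, the partial sums of coefficient norms at radius [t] stay below [2 l t] as soon as
    [4 q l t <= 1].

    The recursion for the coefficients goes by degree, while [psum] truncates to boxes of exponents.
    Words are therefore collapsed onto exponents only at the end, and the absolute bounds absorb the
    difference between the two truncations.

    Analyticity on [Kbeta] asks for agreement with the series only at gains of [Kbeta], which is why
    closedness relative to [Kbeta] is the right notion. Complex vectors are handled as pairs of real
    ones, so that the frequency-domain estimates use only the real form [dotv]. *)

Definition dotv n (x y : 'cV[R]_n) : R := (x^T *m y) 0 0.

Lemma dotvE n (x y : 'cV[R]_n) : dotv x y = \sum_i x i 0 * y i 0.
Proof. by rewrite /dotv mxE; apply: eq_bigr => i _; rewrite mxE. Qed.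

Lemma dotvC n (x y : 'cV[R]_n) : dotv x y = dotv y x.
Proof. by rewrite !dotvE; apply: eq_bigr => i _; rewrite mulrC. Qed.

Lemma dotvDr n (x y z : 'cV[R]_n) : dotv x (y + z) = dotv x y + dotv x z.
Proof. by rewrite /dotv mulmxDr mxE. Qed.

Lemma dotvDl n (x y z : 'cV[R]_n) : dotv (x + y) z = dotv x z + dotv y z.
Proof. by rewrite !(dotvC _ z) dotvDr. Qed.

Lemma dotvZr n a (x y : 'cV[R]_n) : dotv x (a *: y) = a * dotv x y.
Proof. by rewrite /dotv -scalemxAr mxE. Qed.

Lemma dotvZl n a (x y : 'cV[R]_n) : dotv (a *: x) y = a * dotv x y.
Proof. by rewrite dotvC dotvZr dotvC. Qed.

Lemma dotvNr n (x y : 'cV[R]_n) : dotv x (- y) = - dotv x y.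
Proof. by rewrite -scaleN1r dotvZr mulN1r. Qed.

Lemma dotvNl n (x y : 'cV[R]_n) : dotv (- x) y = - dotv x y.
Proof. by rewrite dotvC dotvNr dotvC. Qed.

Lemma dotv0r n (x : 'cV[R]_n) : dotv x 0 = 0.
Proof. by rewrite /dotv mulmx0 mxE. Qed.

Lemma dotv0l n (x : 'cV[R]_n) : dotv 0 x = 0.
Proof. by rewrite dotvC dotv0r. Qed.

Lemma dotv_tr p q (M : 'M[R]_(p, q)) x y : dotv x (M *m y) = dotv (M^T *m x) y.
Proof. by rewrite /dotv trmx_mul trmxK mulmxA. Qed.

Lemma dotvv_ge0 n (x : 'cV[R]_n) : 0 <= dotv x x.
Proof. by rewrite dotvE sumr_ge0 // => i _; rewrite -expr2 sqr_ge0. Qed.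

Lemma dotvv_eq0 n (x : 'cV[R]_n) : (dotv x x == 0) = (x == 0).
Proof.
apply/idP/eqP => [|->]; last by rewrite dotv0r.
rewrite dotvE psumr_eq0 => [/allP h|i _]; last by rewrite -expr2 sqr_ge0.
apply/matrixP => i j; rewrite ord1 mxE; apply/eqP.
by have := h i (mem_index_enum _); rewrite /= mulf_eq0 orbb.
Qed.

Lemma dotvv_gt0 n (x : 'cV[R]_n) : (0 < dotv x x) = (x != 0).
Proof. by rewrite lt_neqAle dotvv_ge0 andbT eq_sym dotvv_eq0. Qed.

Lemma qfE n (X : 'M[R]_n) (v : 'cV[R]_n) : (v^T *m X *m v) 0 0 = dotv v (X *m v).
Proof. by rewrite /dotv mulmxA. Qed.

Lemma dotv_sqr_le n (x y : 'cV[R]_n) : dotv x y ^+ 2 <= dotv x x * dotv y y.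
Proof.
have [->|x0] := eqVneq x 0; first by rewrite !dotv0l expr0n mul0r.
have xx : 0 < dotv x x by rewrite dotvv_gt0.
have := dotvv_ge0 (dotv x x *: y - dotv x y *: x).
rewrite !(dotvDl, dotvDr, dotvNl, dotvNr, dotvZl, dotvZr) (dotvC y x).
set a := dotv x x in xx *; set b := dotv x y; set c := dotv y y => h.
have : 0 <= a * (a * c - b ^+ 2) by apply: le_trans h _; rewrite le_eqVlt; apply/orP; left; apply/eqP; ring.
by rewrite pmulr_rge0 // subr_ge0.
Qed.

(** A crude substitute for the operator norm: it dominates quadratic forms and passes to entrywise
    limits because it is a finite sum. *)
Definition entrysum p q (M : 'M[R]_(p, q)) : R := \sum_i \sum_j `|M i j|.

Lemma entrysum_ge0 p q (M : 'M[R]_(p, q)) : 0 <= entrysum M.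
Proof. by apply: sumr_ge0 => i _; apply: sumr_ge0. Qed.

Lemma sqr_entry_le n (x : 'cV[R]_n) i : x i 0 ^+ 2 <= dotv x x.
Proof.
rewrite dotvE (bigD1 i) //= -expr2 lerDl.
by apply: sumr_ge0 => k _; rewrite -expr2 sqr_ge0.
Qed.

Lemma qf_le n (M : 'M[R]_n) v : `|dotv v (M *m v)| <= entrysum M * dotv v v.
Proof.
rewrite dotvE /entrysum mulr_suml; apply: le_trans (ler_norm_sum _ _ _) _.
apply: ler_sum => i _; rewrite mxE mulr_sumr mulr_suml.
apply: le_trans (ler_norm_sum _ _ _) _; apply: ler_sum => j _.
rewrite mulrCA normrM ler_wpM2l //.
have h1 := sqr_entry_le v i; have h2 := sqr_entry_le v j.
rewrite ler_norml; apply/andP; split.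
  have := sqr_ge0 (v i 0 + v j 0); set a := v i 0 in h1 *; set b := v j 0 in h2 *; nra.
have := sqr_ge0 (v i 0 - v j 0); set a := v i 0 in h1 *; set b := v j 0 in h2 *; nra.
Qed.

Lemma dotv_mulmx_le p q (M : 'M[R]_(p, q)) v :
  dotv (M *m v) (M *m v) <= entrysum (M^T *m M) * dotv v v.
Proof.
rewrite dotv_tr dotvC mulmxA; apply: le_trans (ler_norm _) (qf_le _ _).
Qed.

Lemma psdP n (X : 'M[R]_n) :
  psd X <-> X^T = X /\ forall v, 0 <= dotv v (X *m v).
Proof. by split=> -[h1 h2]; split => // v; have := h2 v; rewrite qfE. Qed.

Lemma pdP n (X : 'M[R]_n) :
  pd X <-> X^T = X /\ forall v, v != 0 -> 0 < dotv v (X *m v).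
Proof. by split=> -[h1 h2]; split => // v /h2; rewrite qfE. Qed.

Lemma pd_psd n (X : 'M[R]_n) : pd X -> psd X.
Proof.
move=> /pdP[sX hX]; apply/psdP; split => // v.
by have [->|/hX/ltW//] := eqVneq v 0; rewrite dotv0l.
Qed.

(** With [w = X v], the form at [v - t w] is [t (t c - 2 b)], where [b = |w|^2] and [c] is the form
    at [w]. For [t = b / (c + b)] this is negative unless [b = 0]; the denominator [c + b] covers
    the case [c = 0]. *)
Lemma psd_null n (X : 'M[R]_n) v : psd X -> dotv v (X *m v) = 0 -> X *m v = 0.
Proof.
move=> /psdP[sX hX] v0; apply/eqP; rewrite -dotvv_eq0.
set w := X *m v; set b := dotv w w; have b0 : 0 <= b := dotvv_ge0 w.
rewrite eq_le b0 andbT leNgt; apply/negP => bp.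
have wv : dotv v (X *m w) = b by rewrite dotv_tr sX.
set c := dotv w (X *m w); have c0 : 0 <= c := hX w.
have := hX (v - (b / (c + b)) *: w).
rewrite mulmxBr -scalemxAr !(dotvDl, dotvDr, dotvNl, dotvNr, dotvZl, dotvZr).
rewrite v0 wv -/w -/b -/c.
have cb : 0 < c + b by rewrite ltr_wpDl.
set t := b / (c + b) => h.
have tp : 0 < t by rewrite divr_gt0.
have tE : t * (c + b) = b by rewrite /t mulfVK // gt_eqF.
have : 0 <= t * (t * c - 2 * b) by apply: le_trans h _; rewrite le_eqVlt; apply/orP; left; apply/eqP; ring.
rewrite pmulr_rge0 // => h2; have := mulr_gt0 tp bp.
by move: tE; rewrite mulrDr; clear -h2 bp; lra.
Qed.

End QuadraticForms.

Section ComplexPairs.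
Variable R : realType.
Local Notation CR := (@CR R).

(** Real matrices act on the two components separately, so complex eigenvectors and resolvents turn
    into pairs of real equations. *)
Definition cpair p q (x y : 'M[R]_(p, q)) : 'M[R[i]]_(p, q) :=
  \matrix_(i, j) Complex (x i j) (y i j).
Definition remx p q (z : 'M[R[i]]_(p, q)) : 'M[R]_(p, q) :=
  \matrix_(i, j) complex.Re (z i j).
Definition immx p q (z : 'M[R[i]]_(p, q)) : 'M[R]_(p, q) :=
  \matrix_(i, j) complex.Im (z i j).

Lemma cpairK p q (z : 'M[R[i]]_(p, q)) : cpair (remx z) (immx z) = z.
Proof. by apply/matrixP => i j; rewrite !mxE; case: (z i j). Qed.

Lemma cpair_inj p q (x y x' y' : 'M[R]_(p, q)) :
  cpair x y = cpair x' y' -> x = x' /\ y = y'.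
Proof.
by move=> /matrixP h; split; apply/matrixP => i j; have := h i j;
   rewrite !mxE => -[].
Qed.

Lemma cpair_eq0 p q (x y : 'M[R]_(p, q)) :
  (cpair x y == 0) = (x == 0) && (y == 0).
Proof.
have c00 : cpair 0 0 = 0 :> 'M[R[i]]_(p, q).
  by apply/matrixP => i j; rewrite !mxE.
apply/eqP/andP => [|[/eqP-> /eqP->] //]; rewrite -c00 => /cpair_inj[-> ->].
by [].
Qed.

Lemma sumCE (I : Type) (r : seq I) (P : pred I) (f g : I -> R) :
  \sum_(i <- r | P i) Complex (f i) (g i) =
  Complex (\sum_(i <- r | P i) f i) (\sum_(i <- r | P i) g i).
Proof. by elim/big_rec3: _ => // i x y z _ ->. Qed.

Lemma mulmx_cpair p q s (M : 'M[R]_(p, q)) (x y : 'M[R]_(q, s)) :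
  map_mx CR M *m cpair x y = cpair (M *m x) (M *m y).
Proof.
apply/matrixP => i j; rewrite !mxE -sumCE; apply: eq_bigr => k _.
by rewrite !mxE /Defs.CR /GRing.mul /= !mul0r subr0 addr0.
Qed.

Lemma scale_cpair p q a b (x y : 'M[R]_(p, q)) :
  Complex a b *: cpair x y = cpair (a *: x - b *: y) (a *: y + b *: x).
Proof.
by apply/matrixP => i j; rewrite !mxE.
Qed.

Lemma sub_cpair p q (x y x' y' : 'M[R]_(p, q)) :
  cpair x y - cpair x' y' = cpair (x - x') (y - y').
Proof. by apply/matrixP => i j; rewrite !mxE. Qed.

Lemma char_polyT n (A : 'M[R]_n) : char_poly A^T = char_poly A.
Proof.
rewrite /char_poly -det_tr; congr (\det _); apply/matrixP => i j.
by rewrite !mxE eq_sym.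
Qed.

Lemma hurwitzT n (A : 'M[R]_n) : hurwitz A -> hurwitz A^T.
Proof. by rewrite /hurwitz char_polyT. Qed.

Lemma map_char_polyCR n (A : 'M[R]_n) :
  map_poly CR (char_poly A) = char_poly (map_mx CR A).
Proof. exact: (map_char_poly (real_complex R)). Qed.

Lemma root_char_polyP n (A : 'M[R]_n) a b :
  root (map_poly CR (char_poly A)) (Complex a b) <->
  exists x y : 'cV[R]_n, [/\ A *m x = a *: x - b *: y, A *m y = a *: y + b *: x
    & (x != 0) || (y != 0)].
Proof.
(* [eigenvalue] is about row vectors; passing to the transpose turns them into the column vectors of
   the statement. *)
rewrite -char_polyT map_char_polyCR -eigenvalue_root_char; split.
  case/eigenvalueP => v vA v0; set w := v^T.
  have : map_mx CR A *m w = Complex a b *: w.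
    by apply: trmx_inj; rewrite trmx_mul trmxK map_trmx vA linearZ /= trmxK.
  have w0 : w != 0 by rewrite trmx_eq0.
  rewrite -(cpairK w) mulmx_cpair scale_cpair => /cpair_inj[h1 h2].
  by exists (remx w), (immx w); rewrite -negb_and -cpair_eq0 cpairK.
case=> x [y [h1 h2 xy]]; apply/eigenvalueP; exists (cpair x y)^T.
  by rewrite -map_trmx -trmx_mul mulmx_cpair h1 h2 -scale_cpair linearZ.
by rewrite trmx_eq0 cpair_eq0 negb_and.
Qed.

Lemma hurwitzP n (A : 'M[R]_n) : hurwitz A <->
  forall a b (x y : 'cV[R]_n), A *m x = a *: x - b *: y ->
    A *m y = a *: y + b *: x -> (x != 0) || (y != 0) -> a < 0.
Proof.
split=> [hA a b x y h1 h2 xy|hA [a b] /root_char_polyP[x [y [h1 h2 xy]]] /=].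
  by apply: (hA (Complex a b)); apply/root_char_polyP; exists x, y.
exact: hA h1 h2 xy.
Qed.

End ComplexPairs.

(** * Sylvester equations and square roots *)

Section Sylvester.
Variable R : realType.
Local Notation toC := (real_complex R).

Lemma horner_mx_intertwine n (F H X : 'M[R]_n.+1) (p : {poly R}) :
  F *m X = X *m H -> horner_mx F p *m X = X *m horner_mx H p.
Proof.
move=> FX; elim/poly_ind: p => [|p c IH]; first by rewrite !rmorph0 mul0mx mulmx0.
rewrite !rmorphD !rmorphM /= !horner_mx_X !horner_mx_C mulmxDl mulmxDr.
rewrite -!mulmxA -[F *m X]/(F *m X) FX !mulmxA IH; congr (_ + _).
by rewrite scalar_mxC.
Qed.

(** The equation says [F X = X H] with [H = - G^T], whose spectrum lies in the right half-plane. The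
    characteristic polynomials of [F] and [H] are thus coprime. Cayley-Hamilton for [F] gives
    [X p(H) = 0] with [p = char_poly F], and the Bezout identity evaluated at [H] makes [p(H)]
    invertible. *)
Lemma sylvester_eq0 n (F G X : 'M[R]_n) : hurwitz F -> hurwitz G ->
  F *m X + X *m G^T = 0 -> X = 0.
Proof.
case: n F G X => [|n] F G X hF hG; first by rewrite [X]flatmx0.
move=> /eqP; rewrite addr_eq0 -mulmxN => /eqP FX.
set H := - G^T in FX.
have /Bezout_eq1_coprimepP[[u v] /= uv] : coprimep (char_poly F) (char_poly H).
  rewrite -(coprimep_map toC); apply/Pdiv.ClosedField.coprimepP => z /hF rz.
  apply/negP => rHz.
  have : complex.Re (- z) < 0.
    apply: hG; rewrite -char_polyT map_char_polyCR -eigenvalue_root_char.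
    move: rHz; rewrite map_char_poly -[_ == 0]/(root _ _) -eigenvalue_root_char.
    case/eigenvalueP => w wH w0; apply/eigenvalueP; exists w => //.
    move: wH; rewrite /H map_mxN mulmxN => /(congr1 -%R).
    by rewrite opprK scaleNr.
  case: z rz {rHz} => a b /=; lra.
have := horner_mx_intertwine (char_poly F) FX.
rewrite Cayley_Hamilton mul0mx => Xp.
have := congr1 (horner_mx H) uv.
rewrite rmorphD !rmorphM rmorph1 /= Cayley_Hamilton mulr0 addr0.
move=> /(congr1 (mulmx X)); rewrite [X *m 1]mulmx1 => <-.
rewrite (comm_horner_mx2 H u (char_poly F)).
by rewrite -[_ * _]/(_ *m _) mulmxA -Xp mul0mx.
Qed.

(** The value is the product of the [n] differences between [a + i b] and the roots, and each has
    real part above [a]. The bound does not depend on [F], so it survives a limit of matrices. *)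
Lemma hurwitz_charpoly_ge n (F : 'M[R]_n) a b : hurwitz F -> 0 <= a ->
  let d := (char_poly (map_mx (@CR R) F)).[Complex a b] in
  a ^+ n ^+ 2 <= complex.Re d ^+ 2 + complex.Im d ^+ 2.
Proof.
move=> hF a0; rewrite -map_char_polyCR; set p := map_poly _ _.
set d := _.[_]; rewrite /=.
have pm : p \is monic by rewrite /p map_char_polyCR char_poly_monic.
have sp : size p = n.+1 by rewrite /p map_char_polyCR size_char_poly.
have [r pr] := closed_field_poly_normal p.
move: pr; rewrite (monicP pm) scale1r => pr.
have sr : size r = n by apply/eq_add_S; rewrite -sp pr size_prod_XsubC.
have dn : (a ^+ n)%:C%C <= `|d|.
  have -> : a ^+ n = \prod_(i < size r) a by rewrite prodr_const card_ord sr.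
  rewrite rmorph_prod /d pr horner_prod normr_prod (big_nth 0) big_mkord.
  apply: ler_prod => i _; rewrite ler0c a0 /= hornerXsubC.
  apply: le_trans (normc_ge_Re _); rewrite lecR.
  have : complex.Re r`_i < 0.
    apply: hF; rewrite -/p pr root_prod_XsubC.
    by apply: mem_nth.
  case: (r`_i) => x y /= x0; apply: le_trans (ler_norm _); lra.
rewrite -lecR add_Re2_Im2 rmorphXn /= lerXn2r // ?nnegrE // ler0c.
exact: exprn_ge0.
Qed.

End Sylvester.

Section SquareRoot.
Variable R : realType.
Local Notation toC := (real_complex R).

Lemma poly_interpolation (K : fieldType) (s : seq K) (f : K -> K) : uniq s ->
  exists p : {poly K}, {in s, forall x, p.[x] = f x}.
Proof.
elim: s => [|a s IH] /=; first by exists 0.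
case/andP=> as_ /IH[p hp]; set q := \prod_(z <- s) ('X - z%:P).
have qa : q.[a] != 0 by rewrite -[_ == 0]/(root q a) root_prod_XsubC.
exists (p + ((f a - p.[a]) / q.[a]) *: q) => x; rewrite inE !hornerE.
case/orP => [/eqP->|xs]; first by rewrite divfK // addrC subrK.
have /rootP-> : root q x by rewrite root_prod_XsubC.
by rewrite mulr0 addr0 hp.
Qed.

Lemma horner_mx_tr n (Q : 'M[R]_n.+1) p : (horner_mx Q p)^T = horner_mx Q^T p.
Proof.
elim/poly_ind: p => [|p c IH]; first by rewrite !rmorph0 trmx0.
rewrite !rmorphD !rmorphM /= !horner_mx_X !horner_mx_C linearD /= tr_scalar_mx.
rewrite trmx_mul IH; congr (_ + _).
by have := comm_horner_mx2 Q^T 'X p; rewrite horner_mx_X.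
Qed.

Lemma horner_mx_spectral_fix (C : numClosedFieldType) n (A : 'M[C]_n.+1) p :
  A \is normalmx -> (forall i, p.[spectral_diag A 0 i] = spectral_diag A 0 i) ->
  horner_mx A p = A.
Proof.
move=> /orthomx_spectralP; set P := spectralmx A; set d := spectral_diag A => AE pd.
have Pu : P \in unitmx := spectral_unit _.
rewrite [in LHS]AE horner_mx_uconjC // horner_mx_diag [RHS]AE.
by congr (_ *m diag_mx _ *m _); apply/rowP => i; rewrite mxE pd.
Qed.

Lemma psd_sqrt n (Q : 'M[R]_n) : psd Q -> exists C : 'M[R]_n, psd C /\ C *m C = Q.
Proof.
case: n Q => [|n] Q pQ.
  by exists Q; split => //; rewrite [Q]flatmx0 [LHS]flatmx0.
have /psdP[sQ hQ] := pQ; set cQ := map_mx toC Q.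
have hermQ : cQ \is hermsymmx.
  apply: realsym_hermsym.
    by apply/is_hermitianmxP; rewrite expr0 scale1r map_mx_id // map_trmx sQ.
  apply/mxOverP => i j; rewrite mxE.
  by apply/complex_realP; eexists.
have /hermitian_normalmx/orthomx_spectralP := hermQ.
set P := spectralmx _; set d := spectral_diag _ => cQE.
have Pu : P \in unitmx := spectral_unit _.
have /mxOverP dreal := hermitian_spectral_diag_real hermQ.
have dE i : d 0 i = (complex.Re (d 0 i))%:C%C by rewrite RRe_real.
have d0 i : 0 <= complex.Re (d 0 i).
  set a := complex.Re _; set w := (row i P)^T.
  have w0 : w != 0.
    rewrite trmx_eq0; apply/negP => /eqP P0.
    have := row_mul i P (invmx P); rewrite mulmxV // P0 mul0mx => /matrixP/(_ 0 i).
    by rewrite !mxE eqxx => /eqP; rewrite oner_eq0.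
  have : cQ *m w = a%:C%C *: w.
    apply: trmx_inj; rewrite trmx_mul trmxK map_trmx sQ linearZ /= trmxK -/cQ.
    rewrite -dE {1}cQE -!row_mul !mulmxA mulmxV // mul1mx.
    by apply/rowP => j; rewrite mxE mul_diag_mx !mxE.
  rewrite -(cpairK w) [cQ *m _]mulmx_cpair scale_cpair => /cpair_inj.
  rewrite !scale0r subr0 addr0 => -[h1 h2].
  have : (remx w != 0) || (immx w != 0) by rewrite -negb_and -cpair_eq0 cpairK.
  case/orP => x0.
    by have := hQ (remx w); rewrite h1 dotvZr pmulr_lge0 // dotvv_gt0.
  by have := hQ (immx w); rewrite h2 dotvZr pmulr_lge0 // dotvv_gt0.
(* Interpolating the fourth root makes [T = r(Q)] symmetric and [T T] a square of a symmetric
   matrix, hence psd at once. Its square is [r^4] evaluated at [Q], and [r^4] fixes every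
   eigenvalue. *)
have [r hr] := poly_interpolation (fun x : R => Num.sqrt (Num.sqrt x))
   (undup_uniq [seq complex.Re (d 0 i) | i <- enum 'I_n.+1]).
have {}hr i : r.[complex.Re (d 0 i)] = Num.sqrt (Num.sqrt (complex.Re (d 0 i))).
  by apply: hr; rewrite mem_undup; apply/mapP; exists i; rewrite ?mem_enum.
set T := horner_mx Q r; have sT : T^T = T by rewrite /T horner_mx_tr sQ.
exists (T *m T); split.
  apply/psdP; split=> [|v]; first by rewrite trmx_mul sT.
  by rewrite -mulmxA dotv_tr sT dotvv_ge0.
have -> : T *m T *m (T *m T) = horner_mx Q (r ^+ 4).
  by rewrite rmorphXn /= -/T !exprS expr0 mulr1 mulrA.
apply: (@map_mx_inj _ _ toC); rewrite map_horner_mx.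
apply: horner_mx_spectral_fix; first exact: hermitian_normalmx hermQ.
move=> i; rewrite -/cQ -/d dE; transitivity (toC (r ^+ 4).[complex.Re (d 0 i)]).
  exact: horner_map.
congr (toC _); rewrite horner_exp hr.
by rewrite (exprM _ 2 2) sqr_sqrtr ?sqrtr_ge0 // sqr_sqrtr.
Qed.

Lemma sqrtmP n (Q : 'M[R]_n) : psd Q -> psd (sqrtm Q) /\ sqrtm Q *m sqrtm Q = Q.
Proof. by move=> /psd_sqrt hQ; apply: (xgetPex 0 hQ). Qed.

(** The square root [C] of [P] is invertible, and [|C v|^2] is the form of [P] at [v]; the constant
    comes from the size of the inverse of [C] in [v = C^-1 (C v)]. *)
Lemma pd_coercive n (P : 'M[R]_n) : pd P ->
  exists2 c, 0 < c & forall v, c * dotv v v <= dotv v (P *m v).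
Proof.
move=> pP; have [/psdP[sC hC] CC] := sqrtmP (pd_psd pP).
set C := sqrtm P in sC hC CC.
have Cu : C \in unitmx.
  rewrite -unitmx_tr; apply: contraT; rewrite -row_free_unit -kermx_eq0 => k0.
  have [v vC v0] := rowV0Pn k0 .
  have /pdP[_ hP] := pP; have := hP v^T; rewrite trmx_eq0 => /(_ v0).
  move/sub_kermxP: vC => vC.
  by rewrite -CC -mulmxA -{2}(trmxK C) -trmx_mul vC trmx0 mulmx0 dotv0r ltxx.
set D := invmx C; set k := entrysum (D^T *m D) + 1.
have k0 : 0 < k by rewrite ltr_wpDl // entrysum_ge0.
exists k^-1; rewrite ?invr_gt0 // => v.
rewrite mulrC ler_pdivrMr // -CC -mulmxA dotv_tr sC.
have -> : dotv v v = dotv (D *m (C *m v)) (D *m (C *m v)) by rewrite mulmxA mulVmx // mul1mx.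
apply: le_trans (dotv_mulmx_le _ _) _.
by rewrite [leRHS]mulrC ler_wpM2r ?dotvv_ge0 // lerDl.
Qed.

End SquareRoot.

(** * Lyapunov equations *)

Section Lyapunov.
Variable R : realType.

(* For symmetric [P], [2 * dotv v (F *m P *m v)] is the quadratic form of [F *m P + P *m F^T]. *)
(* If [P] were not psd, some [P + s *: P0] with [s > 0] would be psd and singular, and the form
   would vanish on its kernel. *)
Lemma psd_of_lyapunov n (F P0 P : 'M[R]_n) : pd P0 ->
  (forall v, v != 0 -> dotv v (F *m P0 *m v) < 0) ->
  P^T = P -> (forall v, dotv v (F *m P *m v) <= 0) -> psd P.
Proof.
move=> pP0 hP0 sP hP; have [c c0 hc] := pd_coercive pP0.
have /pdP[sP0 _] := pP0; have /psdP[_ P0ge0] := pd_psd pP0.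
pose E := [set t : R | 0 <= t /\ psd (P + t *: P0)].
have sPt t : (P + t *: P0)^T = P + t *: P0 by rewrite linearD linearZ /= sP sP0.
have dPt t v : dotv v ((P + t *: P0) *m v) = dotv v (P *m v) + t * dotv v (P0 *m v).
  by rewrite mulmxDl -scalemxAl dotvDr dotvZr.
have E0 : E !=set0.
  exists (entrysum P / c); split; first by rewrite divr_ge0 ?entrysum_ge0 // ltW.
  apply/psdP; split=> // v; rewrite dPt.
  have := qf_le P v; rewrite ler_norml => /andP[+ _].
  have : entrysum P / c * (c * dotv v v) <= entrysum P / c * dotv v (P0 *m v).
    by rewrite ler_wpM2l // divr_ge0 ?entrysum_ge0 // ltW.
  by rewrite mulrA divfK ?gt_eqF //; lra.
have lbE : lbound E 0 by move=> t [].
have iE : has_inf E by split=> //; exists 0.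
set s := inf E; have s0 : 0 <= s by apply: lb_le_inf.
have pM : psd (P + s *: P0).
  apply/psdP; split=> // v; rewrite leNgt dPt; apply/negP => neg.
  set q := dotv v (P0 *m v) in neg; have q0 : 0 <= q := P0ge0 v.
  set p := dotv v (P *m v) in neg.
  (* A member [t] of [E] this close to [s] would still give the negative value [p + t q]. The
     denominator [q + 1] covers [q = 0]. *)
  have e0 : 0 < - (p + s * q) / (q + 1) by rewrite divr_gt0 ?oppr_gt0 ?ltr_wpDl.
  have [t [_ /psdP[_ /(_ v)]]] := inf_adherent e0 iE.
  rewrite dPt -/p -/q -/s => h1 h2.
  have : (- (p + s * q)) / (q + 1) * q < - (p + s * q) \/ q = 0.
    have [->|qn] := eqVneq q 0; [by right|left].
    rewrite -mulrA gtr_pMr ?oppr_gt0 // mulrC ltr_pdivrMr ?ltr_wpDl //; lra.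
  case=> [h3|qz]; last by move: h1 neg; rewrite qz !mulr0; lra.
  have : (t - s) * q <= - (p + s * q) / (q + 1) * q by rewrite ler_wpM2r //; lra.
  by rewrite mulrBl; lra.
have [sz|sn] := eqVneq s 0; first by move: pM; rewrite sz scale0r addr0.
have {sn} sp : 0 < s by rewrite lt_neqAle eq_sym sn.
have [pdM|] := pselect (pd (P + s *: P0)).
  have [d d0 hd] := pd_coercive pdM.
  set k := entrysum P0 + 1; have k0 : 0 < k by rewrite ltr_wpDl // entrysum_ge0.
  set e := Num.min s (d / k).
  have e0 : 0 < e by rewrite lt_min sp divr_gt0.
  have : E (s - e).
    split; first by rewrite subr_ge0 ge_min lexx.
    apply/psdP; split=> // v; have := hd v; rewrite !dPt mulrBl.
    have : e * dotv v (P0 *m v) <= d * dotv v v.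
      have h1 : dotv v (P0 *m v) <= k * dotv v v.
        apply: le_trans (le_trans (ler_norm _) (qf_le _ _)) _.
        by rewrite ler_wpM2r ?dotvv_ge0 // lerDl.
      have h2 : e <= d / k by rewrite ge_min lexx orbT.
      have := ler_pM (ltW e0) (P0ge0 v) h2 h1.
      by rewrite mulrA divfK // gt_eqF.
    lra.
  by move/(ge_inf iE.2); rewrite -/s; lra.
move=> npd; have [v [v0 qv]] : exists v, v != 0 /\ dotv v ((P + s *: P0) *m v) = 0.
  apply: contrapT => /forallNP h; apply: npd; apply/pdP; split=> // v v0.
  have /psdP[_ /(_ v)] := pM; rewrite le_eqVlt => /orP[/eqP e|//].
  by case: (h v).
have := psd_null pM qv => Mv.
have : dotv v (F *m (P + s *: P0) *m v) = 0 by rewrite -mulmxA Mv mulmx0 dotv0r.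
rewrite mulmxDr mulmxDl -scalemxAr -scalemxAl dotvDr dotvZr.
have := hP v; have := mulr_gt0 sp (_ : 0 < - dotv v (F *m P0 *m v)).
by rewrite oppr_gt0 hP0 // => /(_ erefl); rewrite mulrN; lra.
Qed.

Definition sylvester_op n (F : 'M[R]_n) : 'End('M[R]_n) :=
  linfun (GRing.add_fun (mulmx F) (mulmxr F^T)).

Lemma sylvester_opE n (F X : 'M[R]_n) : sylvester_op F X = F *m X + X *m F^T.
Proof. by rewrite lfunE. Qed.

Lemma sylvester_opVK n (F : 'M[R]_n) : hurwitz F ->
  cancel (sylvester_op F)^-1%VF (sylvester_op F).
Proof.
move=> hF; apply: lker0_lfunVK; apply/lker0P => X Y.
rewrite !sylvester_opE => /eqP; rewrite -subr_eq0 => /eqP h.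
apply/eqP; rewrite -subr_eq0; apply/eqP; apply: (sylvester_eq0 hF hF).
by rewrite -h mulmxBr mulmxBl opprD addrACA.
Qed.

Lemma sylvester_sym n (F X Q : 'M[R]_n) : hurwitz F ->
  F *m X + X *m F^T = Q -> Q^T = Q -> X^T = X.
Proof.
move=> hF FX sQ; apply/eqP; rewrite -subr_eq0; apply/eqP.
apply: (sylvester_eq0 hF hF); rewrite mulmxBr mulmxBl addrACA -opprD FX.
have := congr1 trmx FX; rewrite linearD /= !trmx_mul trmxK sQ [X^T *m _ + _]addrC => ->.
by rewrite subrr.
Qed.

Lemma hurwitz_shift n (F : 'M[R]_n) s : hurwitz F -> 0 <= s -> hurwitz (F - s%:M).
Proof.
move=> /hurwitzP hF s0; apply/hurwitzP => a b x y.
rewrite !mulmxBl !mul_scalar_mx => h1 h2 xy.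
have : a + s < 0; last lra.
apply: (hF _ b x y) xy; rewrite scalerDl.
  by rewrite -[LHS](subrK (s *: x)) h1 addrAC.
by rewrite -[LHS](subrK (s *: y)) h2 addrAC.
Qed.

(* [F - s] satisfies the conclusion for large [s]; solving the Lyapunov equation at the infimum
   of such [s] shows that this infimum is [0]. *)
Lemma lyapunov n (F : 'M[R]_n) : hurwitz F -> exists P, pd P /\
  exists2 c, 0 < c & forall v, dotv v (F *m P *m v) <= - (c * dotv v v).
Proof.
move=> hF; pose L s := exists P, pd P /\
  exists2 c, 0 < c & forall v, dotv v ((F - s%:M) *m P *m v) <= - (c * dotv v v).
pose E := [set s : R | 0 <= s /\ L s].
have shiftE s (P : 'M[R]_n) v :
    dotv v ((F - s%:M) *m P *m v) = dotv v (F *m P *m v) - s * dotv v (P *m v).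
  by rewrite !mulmxBl mul_scalar_mx -scalemxAl dotvDr dotvNr dotvZr.
have E0 : E !=set0.
  exists (entrysum F + 1); split; first by rewrite addr_ge0 ?entrysum_ge0.
  exists 1%:M; split.
    by apply/pdP; split=> [|v v0]; rewrite ?trmx1 // mul1mx dotvv_gt0.
  exists 1 => // v; rewrite shiftE mulmx1 mul1mx mulrDl.
  by have := le_trans (ler_norm _) (qf_le F v); lra.
have lbE : lbound E 0 by move=> t [].
have iE : has_inf E by split=> //; exists 0.
set s := inf E; have s0 : 0 <= s by apply: lb_le_inf.
have hFs := hurwitz_shift hF s0.
set P := (sylvester_op (F - s%:M))^-1%VF (- 1%:M).
have PE : (F - s%:M) *m P + P *m (F - s%:M)^T = - 1%:M.
  by rewrite -sylvester_opE sylvester_opVK.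
have sP : P^T = P by apply: (sylvester_sym hFs PE); rewrite linearN /= trmx1.
have lP v : dotv v ((F - s%:M) *m P *m v) = - (dotv v v / 2).
  have := congr1 (fun M => dotv v (M *m v)) PE.
  rewrite mulmxDl mulNmx mul1mx dotvDr dotvNr -[P *m _ *m v]mulmxA.
  rewrite [dotv v (P *m _)]dotv_tr sP [dotv (P *m v) _]dotv_tr trmxK [dotv _ v]dotvC mulmxA.
  lra.
set k := entrysum P + 1; have k0 : 0 < k by rewrite ltr_wpDl // entrysum_ge0.
have kP v : `|dotv v (P *m v)| <= k * dotv v v.
  by apply: le_trans (qf_le _ _) _; rewrite ler_wpM2r ?dotvv_ge0 // lerDl.
have e0 : 0 < (4 * k)^-1 by rewrite invr_gt0 mulr_gt0.
(* The form of [(F - s) P] has slack 1/2, and a shift by at most [1 / (4 k)] costs 1/4. The same [P]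
   therefore serves on both sides of [s]: above, to prove it psd, and at or below, to contradict the
   infimum or to conclude. *)
have kshift t v : `|t - s| <= (4 * k)^-1 ->
    dotv v ((F - t%:M) *m P *m v) <= - (4^-1 * dotv v v).
  move=> ts; rewrite shiftE.
  have := lP v; rewrite shiftE => h.
  have : - ((t - s) * dotv v (P *m v)) <= 4^-1 * dotv v v.
    apply: le_trans (ler_norm _) _; rewrite normrN normrM.
    apply: le_trans (ler_pM _ _ ts (kP v)) _ => //.
    by rewrite mulrA invfM divfK // gt_eqF.
  rewrite mulrBl; lra.
have pP : pd P.
  have psP : psd P.
    have [t Et ts] := inf_adherent e0 iE.
    have [t0 [P0 [pP0 [c c0 hc]]]] := Et.
    apply: (psd_of_lyapunov (F := F - t%:M) pP0) => // [v v0|v].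
      apply: le_lt_trans (hc v) _.
      by rewrite oppr_lt0 mulr_gt0 // dotvv_gt0.
    have st : s <= t by apply: (ge_inf iE.2 Et).
    apply: le_trans (kshift t v _) _; first by rewrite ger0_norm ?subr_ge0 // lerBlDl ltW.
    by rewrite oppr_le0 mulr_ge0 // dotvv_ge0.
  apply/pdP; split=> // v v0; have /psdP[_ /(_ v)] := psP.
  rewrite le_eqVlt => /orP[/eqP/esym/(psd_null psP) Pv|//].
  have := lP v; rewrite -mulmxA Pv mulmx0 dotv0r.
  by move: v0; rewrite -dotvv_gt0; lra.
have := s0; rewrite le_eqVlt => /orP[/eqP sz|sp].
  exists P; split=> //; exists 4^-1 => // v.
  have := kshift 0 v; rewrite [0%:M]raddf0 subr0; apply.
  by rewrite -sz subrr normr0 ltW.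
set t := Num.max 0 (s - (4 * k)^-1).
have ts : t < s by rewrite gt_max sp /=; lra.
suff /(ge_inf iE.2) : E t by rewrite leNgt ts.
split; first by rewrite le_max lexx.
exists P; split=> //; exists 4^-1 => // v; apply: kshift.
rewrite ler0_norm; last by lra.
by rewrite opprB lerBlDr -lerBlDl le_max lexx orbT.
Qed.

Lemma lyapunov_psd n (F P : 'M[R]_n) : hurwitz F -> P^T = P ->
  (forall v, dotv v (F *m P *m v) <= 0) -> psd P.
Proof.
move=> /lyapunov[P0 [pP0 [c c0 hc]]]; apply: psd_of_lyapunov pP0 _ => v v0.
by apply: le_lt_trans (hc v) _; rewrite oppr_lt0 mulr_gt0 // dotvv_gt0.
Qed.

Lemma hurwitz_of_lyapunov n (F P : 'M[R]_n) : psd P ->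
  (forall v, v != 0 -> dotv v (F *m P *m v) < 0) -> hurwitz F.
Proof.
move=> /psdP[sP hP] hF; rewrite -(trmxK F); apply/hurwitzT/hurwitzP.
move=> a b x y h1 h2 xy.
have qE v : dotv v (F *m P *m v) = dotv (F^T *m v) (P *m v).
  by rewrite -mulmxA dotv_tr.
have : dotv x (F *m P *m x) + dotv y (F *m P *m y) < 0.
  have hF0 v : dotv v (F *m P *m v) <= 0.
    by have [->|/hF/ltW//] := eqVneq v 0; rewrite dotv0l.
  case/orP: xy => /hF h; [have := hF0 y|have := hF0 x]; lra.
rewrite !qE h1 h2 !(dotvDl, dotvNl, dotvZl).
have -> : dotv y (P *m x) = dotv x (P *m y) by rewrite dotv_tr sP dotvC.
move=> h; rewrite ltNge; apply/negP => a0.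
by have := mulr_ge0 a0 (hP x); have := mulr_ge0 a0 (hP y); lra.
Qed.

(** Take a Lyapunov matrix [P] of [A^T] and add its inequalities at [x] and [y]. The terms in [w]
    cancel since [P] is symmetric, which makes the bound uniform in the frequency. What remains is
    [c (|x|^2 + |y|^2) <= g1.P x + g2.P y], and Young's inequality finishes. *)
Lemma resolvent_bound n (A : 'M[R]_n) : hurwitz A -> exists2 k, 0 <= k &
  forall w (x y : 'cV[R]_n),
  let g1 := - (w *: y) - A *m x in let g2 := w *: x - A *m y in
  dotv x x + dotv y y <= k * (dotv g1 g1 + dotv g2 g2).
Proof.
move=> /hurwitzT/lyapunov[P [pP [c c0 hc]]].
have /pdP[sP _] := pP.
set k := entrysum (P^T *m P) + 1; have k0 : 0 < k by rewrite ltr_wpDl // entrysum_ge0.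
have hk v : dotv (P *m v) (P *m v) <= k * dotv v v.
  by apply: le_trans (dotv_mulmx_le _ _) _; rewrite ler_wpM2r ?dotvv_ge0 // lerDl.
exists (k / c ^+ 2) => [|w x y].
  by rewrite divr_ge0 ?ltW // exprn_gt0.
set g1 := - (w *: y) - A *m x; set g2 := w *: x - A *m y => /=.
have qE v : dotv v (A^T *m P *m v) = dotv (A *m v) (P *m v).
  by rewrite -mulmxA dotv_tr trmxK.
have := hc x; have := hc y; rewrite !qE.
have e1 : A *m x = - (w *: y) - g1 by rewrite /g1 opprB addrC subrK.
have e2 : A *m y = w *: x - g2 by rewrite /g2 opprB addrC subrK.
clearbody g1 g2; rewrite e1 e2 !(dotvDl, dotvNl, dotvZl).
have -> : dotv y (P *m x) = dotv x (P *m y) by rewrite dotv_tr sP dotvC.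
have young g v : 2 * (c * dotv g (P *m v)) * k <= dotv g g * k ^+ 2 + c ^+ 2 * (k * dotv v v).
  have := dotvv_ge0 (k *: g - c *: (P *m v)).
  rewrite !(dotvDl, dotvNl, dotvZl, dotvDr, dotvNr, dotvZr) (dotvC (P *m v) g).
  have : c ^+ 2 * dotv (P *m v) (P *m v) <= c ^+ 2 * (k * dotv v v).
    by rewrite ler_wpM2l ?hk // exprn_ge0 // ltW.
  set u := dotv (P *m v) _; set z := dotv v v; set G := dotv g g; set p := dotv g _.
  by rewrite !expr2; lra.
have := young g1 x; have := young g2 y.
set X := dotv x x; set Y := dotv y y; set G1 := dotv g1 g1; set G2 := dotv g2 g2.
set p1 := dotv g1 _; set p2 := dotv g2 _ => h1 h2 h3 h4.
have h5 : c * (X + Y) <= p1 + p2 by lra.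
rewrite mulrAC ler_pdivlMr ?exprn_gt0 // -(ler_pM2l k0).
have h6 : 0 <= c * k * (p1 + p2 - c * (X + Y)).
  by rewrite mulr_ge0 ?subr_ge0 // ltW // mulr_gt0.
clear -h1 h2 h6; nra.
Qed.

End Lyapunov.

(** * The H-infinity bound and imaginary eigenvalues *)

Section FrequencyDomain.
Variable R : realType.
Local Notation CR := (@CR R).

Definition transfer n p q (C : 'M[R]_(p, n)) (A : 'M[R]_n) (B : 'M[R]_(n, q)) (w : R) :
    'M[R[i]]_(p, q) :=
  map_mx CR C *m invmx ((Complex 0 w)%:M - map_mx CR A) *m map_mx CR B.

Lemma cvnorm_ge0 k (v : 'cV[R[i]]_k) : 0 <= cvnorm v.
Proof. exact: sqrtr_ge0. Qed.

Lemma cvnorm_cpair k (x y : 'cV[R]_k) :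
  cvnorm (cpair x y) ^+ 2 = dotv x x + dotv y y.
Proof.
rewrite sqr_sqrtr; last by apply: sumr_ge0 => i _; rewrite addr_ge0 ?sqr_ge0.
by rewrite !dotvE -big_split; apply: eq_bigr => i _; rewrite !mxE /= !expr2.
Qed.

Lemma resolvent_cpair n (A : 'M[R]_n) w (x y : 'cV[R]_n) :
  ((Complex 0 w)%:M - map_mx CR A) *m cpair x y =
  cpair (- (w *: y) - A *m x) (w *: x - A *m y).
Proof.
by rewrite mulmxBl mul_scalar_mx mulmx_cpair scale_cpair sub_cpair !scale0r sub0r add0r.
Qed.

Lemma resolvent_unit n (A : 'M[R]_n) w : hurwitz A ->
  (Complex 0 w)%:M - map_mx CR A \in unitmx.
Proof.
move=> /resolvent_bound[k k0 hk]; set M := _ - _.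
rewrite -unitmx_tr; apply: contraT; rewrite -row_free_unit -kermx_eq0 => ker0.
have [v vM v0] := rowV0Pn ker0.
have : M *m v^T = 0.
  by apply: trmx_inj; rewrite trmx_mul trmxK trmx0; apply/sub_kermxP.
rewrite -(cpairK v^T) resolvent_cpair => /eqP; rewrite cpair_eq0 => /andP[/eqP h1 /eqP h2].
have := hk w (remx v^T) (immx v^T); rewrite h1 h2 /= !dotv0r addr0 mulr0 => h.
have h3 := dotvv_ge0 (remx v^T); have h4 := dotvv_ge0 (immx v^T).
case/negP: v0; rewrite -trmx_eq0 -(cpairK v^T) cpair_eq0 -!dotvv_eq0.
by apply/andP; split; apply/eqP; lra.
Qed.

Lemma transfer_mul n p q (C : 'M[R]_(p, n)) (A : 'M[R]_n) (B : 'M[R]_(n, q)) w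
    (g1 g2 : 'cV[R]_n) (z1 z2 : 'cV[R]_q) : hurwitz A ->
  - (w *: g2) - A *m g1 = B *m z1 -> w *: g1 - A *m g2 = B *m z2 ->
  transfer C A B w *m cpair z1 z2 = cpair (C *m g1) (C *m g2).
Proof.
move=> hA h1 h2; rewrite /transfer -!mulmxA mulmx_cpair -h1 -h2 -resolvent_cpair.
by rewrite mulKmx ?resolvent_unit // mulmx_cpair.
Qed.

Lemma resolvent_solve n (A : 'M[R]_n) w (u1 u2 : 'cV[R]_n) : hurwitz A ->
  exists g1 g2, - (w *: g2) - A *m g1 = u1 /\ w *: g1 - A *m g2 = u2.
Proof.
move=> hA; set M := (Complex 0 w)%:M - map_mx CR A.
exists (remx (invmx M *m cpair u1 u2)), (immx (invmx M *m cpair u1 u2)).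
by apply: cpair_inj; rewrite -resolvent_cpair cpairK mulKVmx // resolvent_unit.
Qed.

(** A [sup] carries information only for bounded sets. This bound, uniform in [w], covers both the
    [sup] in [opnorm] and the one over frequencies. *)
Lemma transfer_bounded n p q (C : 'M[R]_(p, n)) (A : 'M[R]_n) (B : 'M[R]_(n, q)) :
  hurwitz A -> exists2 k, 0 <= k &
  forall w v, cvnorm (transfer C A B w *m v) <= k * cvnorm v.
Proof.
move=> hA; have [k k0 hk] := resolvent_bound hA.
set c := entrysum (C^T *m C); set b := entrysum (B^T *m B).
have c0 : 0 <= c := entrysum_ge0 _; have b0 : 0 <= b := entrysum_ge0 _.
exists (Num.sqrt (c * k * b)) => [|w v]; first exact: sqrtr_ge0.
rewrite -ler_sqr ?nnegrE ?mulr_ge0 ?sqrtr_ge0 // exprMn [X in _ <= X * _]sqr_sqrtr ?mulr_ge0 //.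
rewrite -(cpairK v); set z1 := remx v; set z2 := immx v.
have [g1 [g2 [h1 h2]]] := resolvent_solve w (B *m z1) (B *m z2) hA.
rewrite (transfer_mul C hA h1 h2) !cvnorm_cpair.
have := hk w g1 g2; rewrite h1 h2 /= => hg.
have := dotv_mulmx_le C g1; have := dotv_mulmx_le C g2; rewrite -/c => e2 e1.
have := dotv_mulmx_le B z1; have := dotv_mulmx_le B z2; rewrite -/b => f2 f1.
have e3 := ler_wpM2l c0 hg; have := ler_wpM2l k0 (lerD f1 f2) => /(ler_wpM2l c0) e4.
apply: le_trans (lerD e1 e2) _; rewrite -mulrDr; apply: le_trans e3 _.
by apply: le_trans e4 _; rewrite -mulrDr !mulrA.
Qed.

Lemma transfer_sup n p q (C : 'M[R]_(p, n)) (A : 'M[R]_n) (B : 'M[R]_(n, q)) :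
  hurwitz A -> forall w v, cvnorm (transfer C A B w *m v) <=
    sup [set opnorm (transfer C A B w) | w in [set: R]] * cvnorm v.
Proof.
move=> hA w v; have [k k0 hk] := transfer_bounded C B hA.
set g := sup _.
have ball0 : cvnorm (0 : 'cV[R[i]]_q) = 0.
  by rewrite /cvnorm big1 ?sqrtr0 // => i _; rewrite mxE /= expr0n addr0.
have nonempty w' : [set cvnorm (transfer C A B w' *m v) | v in
     [set v : 'cV[R[i]]_q | cvnorm v <= 1]] !=set0.
  by exists (cvnorm (transfer C A B w' *m 0)); exists 0 => //=; rewrite ball0.
have ubk w' : ubound [set cvnorm (transfer C A B w' *m v) | v in
     [set v : 'cV[R[i]]_q | cvnorm v <= 1]] k.
  by move=> _ [u /= u1 <-]; apply: le_trans (hk _ _) _; rewrite -[leRHS]mulr1 ler_wpM2l.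
have opk w' : opnorm (transfer C A B w') <= k by apply: ge_sup.
have opg w' : opnorm (transfer C A B w') <= g.
  by apply: ub_le_sup; [exists k => _ [u _ <-]|exists w'].
have [v0|vn] := eqVneq (cvnorm v) 0.
  by rewrite v0 mulr0; apply: le_trans (hk _ _) _; rewrite v0 mulr0.
have vp : 0 < cvnorm v by rewrite lt_neqAle eq_sym vn cvnorm_ge0.
have cvZ k' (t : R) (u : 'cV[R[i]]_k') : 0 <= t -> cvnorm (CR t *: u) = t * cvnorm u.
  move=> t0; apply/eqP; rewrite -(@eqrXn2 _ 2) ?mulr_ge0 ?cvnorm_ge0 //.
  rewrite exprMn -(cpairK u) scale_cpair !scale0r subr0 addr0 !cvnorm_cpair.
  by rewrite !dotvZl !dotvZr; apply/eqP; ring.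
rewrite -ler_pdivrMr // mulrC -cvZ ?invr_ge0 ?cvnorm_ge0 // scalemxAr.
apply: le_trans (opg w); apply: ub_le_sup; first by exists k; apply: ubk.
by exists (CR (cvnorm v)^-1 *: v) => //=; rewrite cvZ ?invr_ge0 ?cvnorm_ge0 // mulVf.
Qed.

Lemma riccati_form n (A S X W : 'M[R]_n) b v : X^T = X ->
  A *m X + X *m A^T + b *: (X *m S *m X) + W = 0 ->
  2 * dotv (A^T *m v) (X *m v) + b * dotv (X *m v) (S *m (X *m v)) + dotv v (W *m v) = 0.
Proof.
move=> sX /(congr1 (fun M => dotv v (M *m v))).
rewrite !mulmxDl -scalemxAl !dotvDr dotvZr mul0mx dotv0r -!mulmxA.
rewrite (dotv_tr A) (dotv_tr X v (A^T *m v)) sX (dotvC (X *m v) (A^T *m v)).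
by rewrite (dotv_tr X v (S *m _)) sX; lra.
Qed.

(* The real form of: an eigenvector [y^*] of [A + b X S] on the left, with eigenvalue [iw],
   yields the input [z = Bw^* y] on which the transfer matrix has gain at least [beta]. *)
Lemma riccati_no_imaginary_eigenvalue n p (A Bw X : 'M[R]_n) (C : 'M[R]_(p, n)) beta :
  hurwitz A -> 0 < beta ->
  (forall v, v != 0 -> 0 < dotv v (C^T *m C *m v)) ->
  sup [set opnorm (transfer C A Bw w) | w in [set: R]] < beta ->
  X^T = X ->
  A *m X + X *m A^T + beta ^- 2 *: (X *m (C^T *m C) *m X) + Bw *m Bw^T = 0 ->
  forall w (x y : 'cV[R]_n),
  (A + beta ^- 2 *: (X *m (C^T *m C)))^T *m x = - (w *: y) ->
  (A + beta ^- 2 *: (X *m (C^T *m C)))^T *m y = w *: x -> x = 0 /\ y = 0.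
Proof.
move=> hA beta0; set S := C^T *m C => pS supT sX ric w x y.
set b := beta ^- 2.
have sS : S^T = S by rewrite /S trmx_mul trmxK.
have SE t : dotv t (S *m t) = dotv (C *m t) (C *m t) by rewrite -mulmxA dotv_tr trmxK.
clearbody S.
have b0 : 0 < b by rewrite invr_gt0 exprn_gt0.
have FE v : (A + b *: (X *m S))^T *m v = A^T *m v + b *: (S *m (X *m v)).
  by rewrite linearD linearZ /= trmx_mul sS sX mulmxDl -scalemxAl mulmxA.
rewrite !FE; set u := X *m x; set v := X *m y => h1 h2.
have A1 : A^T *m x = - (w *: y) - b *: (S *m u) by rewrite -h1 addrK.
have A2 : A^T *m y = w *: x - b *: (S *m v) by rewrite -h2 addrK.
set z1 := Bw^T *m x; set z2 := Bw^T *m y.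
have ricq t : 2 * dotv (A^T *m t) (X *m t) + b * dotv (X *m t) (S *m (X *m t))
    + dotv (Bw^T *m t) (Bw^T *m t) = 0.
  by have := riccati_form t sX ric; rewrite -[Bw *m _ *m t]mulmxA (dotv_tr Bw).
have := ricq x; have := ricq y.
rewrite A1 A2 -/u -/v -/z1 -/z2 !(dotvDl, dotvNl, dotvZl).
have -> : dotv y u = dotv x v by rewrite /u /v dotv_tr sX dotvC.
rewrite (dotvC (S *m u)) (dotvC (S *m v)) => r2 r1.
(* The Riccati equation tested at [x] and at [y]: in the sum the terms in [w] cancel. In complex
   notation, [|C X y|^2 = beta^2 |Bw^* y|^2] for the eigenvector. *)
have rN : b * (dotv u (S *m u) + dotv v (S *m v)) = dotv z1 z1 + dotv z2 z2 by lra.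
have [g1 [g2 [e1 e2]]] := resolvent_solve (- w) (Bw *m z1) (Bw *m z2) hA.
have := transfer_sup C Bw hA (- w) (cpair z1 z2).
rewrite (transfer_mul C hA e1 e2) => hT.
(* Here [g1 + i g2] is the state driven by the input [z1 + i z2] at frequency [-w]. Moving the
   resolvent onto the eigenvector leaves only [b S u] and [b S v], up to terms in [w] that cancel
   between [zz1] and [zz2]. *)
have zz1 : dotv z1 z1 = w * dotv x g2 + (w * dotv y g1 + b * dotv u (S *m g1)).
  rewrite {1}/z1 -dotv_tr -e1 dotvDr !dotvNr dotvZr (dotv_tr A x) A1.
  by rewrite !(dotvDl, dotvNl, dotvZl) -[dotv (S *m u) _]/(dotv (S *m u) g1)
      -{1}sS -dotv_tr; ring.
have zz2 : dotv z2 z2 = - w * dotv y g1 + (- w * dotv x g2 + b * dotv v (S *m g2)).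
  rewrite {1}/z2 -dotv_tr -e2 dotvDr !dotvNr dotvZr (dotv_tr A y) A2.
  by rewrite !(dotvDl, dotvNl, dotvZl) -{1}sS -dotv_tr; ring.
have Sge0 t : 0 <= dotv t (S *m t) by rewrite SE dotvv_ge0.
set g := sup _ in supT hT.
set N := dotv z1 z1 + dotv z2 z2 in rN.
have N0 : 0 <= N by rewrite addr_ge0 ?dotvv_ge0.
have gT : dotv g1 (S *m g1) + dotv g2 (S *m g2) <= Num.max 0 g ^+ 2 * N.
  rewrite !SE /N -!cvnorm_cpair -exprMn ler_sqr ?nnegrE ?mulr_ge0 ?cvnorm_ge0 ?le_max ?lexx //.
  by apply: le_trans hT _; rewrite ler_wpM2r ?cvnorm_ge0 // le_max lexx orbT.
have gb : Num.max 0 g ^+ 2 < beta ^+ 2.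
  have m0 : Num.max 0 g \is Num.nneg by rewrite nnegrE le_max lexx.
  by rewrite ltr_sqr ?gt_max ?beta0 // nnegrE ltW.
have sq r t : dotv r (S *m t) * 2 <= dotv r (S *m r) + dotv t (S *m t).
  have := Sge0 (r - t); rewrite mulmxBr !(dotvDl, dotvNl, dotvDr, dotvNr).
  by rewrite (dotv_tr S t r) sS (dotvC _ r); lra.
have := sq u g1; have := sq v g2 => q2 q1.
have bK : beta ^+ 2 * b = 1 by rewrite /b divff // gt_eqF // exprn_gt0.
have rN2 : dotv u (S *m u) + dotv v (S *m v) = beta ^+ 2 * N.
  by rewrite -rN mulrA bK mul1r.
have rN3 : dotv u (S *m g1) + dotv v (S *m g2) = beta ^+ 2 * N.
  have -> : N = b * (dotv u (S *m g1) + dotv v (S *m g2)) by rewrite /N zz1 zz2; ring.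
  by rewrite mulrA bK mul1r.
(* In the form [S], the pair [(u, v)] has square norm [beta^2 N] and the same product with
   [(g1, g2)], whose square norm is at most [max(0, g)^2 N]. Since [g < beta], this forces [N = 0];
   then [u = v = 0], and [A^T] itself would have the eigenvalue [i w]. *)
have : 0 <= (Num.max 0 g ^+ 2 - beta ^+ 2) * N by rewrite mulrBl; lra.
rewrite nmulr_rge0 ?subr_lt0 // => Nle0.
have Nz : N = 0 by apply/eqP; rewrite eq_le Nle0 N0.
have Sz t : dotv t (S *m t) <= 0 -> t = 0.
  by move=> h; apply/eqP; apply: contraT => /pS; rewrite ltNge h.
rewrite Nz mulr0 in rN2.
have uz : u = 0 by apply: Sz; have := Sge0 v; lra.
have vz : v = 0 by apply: Sz; have := Sge0 u; lra.
move: A1 A2; rewrite uz vz !mulmx0 !scaler0 !subr0 => A1 A2.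
have /hurwitzP/(_ 0 w x y) := hurwitzT hA.
rewrite !scale0r sub0r add0r ltxx => /(_ A1 A2).
by case: eqVneq => [->|_]; case: eqVneq => [->|_] //= /(_ isT).
Qed.

End FrequencyDomain.

(** * Entrywise limits *)

Section EntrywiseLimits.
Variable R : realType.

Lemma cvg_subsequence (u : nat -> R) (l : R) (f : nat -> nat) : (forall n, (n <= f n)%N) ->
  u @ \oo --> l -> u \o f @ \oo --> l.
Proof.
move=> hf ul; apply: (cvg_comp f u) ul => A [N _ hN]; exists N => // n /= Nn.
by apply: hN => /=; apply: leq_trans Nn (hf n).
Qed.

Lemma cvg_bigsum (I : Type) (r : seq I) (P : pred I) (u : I -> nat -> R) (l : I -> R) :
  (forall i, P i -> u i @ \oo --> l i) ->
  (fun k => \sum_(i <- r | P i) u i k) @ \oo --> \sum_(i <- r | P i) l i.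
Proof.
move=> h; elim: r => [|i r IH].
  rewrite big_nil; under eq_fun do rewrite big_nil; exact: cvg_cst.
rewrite big_cons; under eq_fun do rewrite big_cons.
by case: ifP => [Pi|_] //; apply: cvgD => //; apply: h.
Qed.

Definition mcvg p q (u : nat -> 'M[R]_(p, q)) (l : 'M[R]_(p, q)) :=
  forall i j, (fun k => u k i j) @ \oo --> l i j.

Lemma mcvg_cst p q (l : 'M[R]_(p, q)) : mcvg (fun=> l) l.
Proof. by move=> i j; apply: cvg_cst. Qed.

Lemma mcvg_unique p q (u : nat -> 'M[R]_(p, q)) l l' : mcvg u l -> mcvg u l' -> l = l'.
Proof. by move=> h h'; apply/matrixP => i j; apply: cvg_unique (h i j) (h' i j). Qed.

Lemma mcvgD p q (u v : nat -> 'M[R]_(p, q)) a b :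
  mcvg u a -> mcvg v b -> mcvg (fun k => u k + v k) (a + b).
Proof.
move=> ua vb i j; rewrite mxE; under eq_fun do rewrite mxE.
exact: cvgD (ua i j) (vb i j).
Qed.

Lemma mcvgM p q s (u : nat -> 'M[R]_(p, q)) (v : nat -> 'M[R]_(q, s)) a b :
  mcvg u a -> mcvg v b -> mcvg (fun k => u k *m v k) (a *m b).
Proof.
move=> ua vb i j; rewrite mxE; under eq_fun do rewrite mxE.
by apply: cvg_bigsum => k _; apply: cvgM.
Qed.

Lemma mcvgZ p q c (u : nat -> 'M[R]_(p, q)) a :
  mcvg u a -> mcvg (fun k => c *: u k) (c *: a).
Proof.
move=> ua i j; rewrite mxE; under eq_fun do rewrite mxE.
exact: cvgMr.
Qed.

Lemma mcvgT p q (u : nat -> 'M[R]_(p, q)) a : mcvg u a -> mcvg (fun k => (u k)^T) a^T.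
Proof. by move=> ua i j; rewrite mxE; under eq_fun do rewrite mxE; apply: ua. Qed.

Lemma mcvg_subsequence p q (u : nat -> 'M[R]_(p, q)) a (f : nat -> nat) :
  (forall n, (n <= f n)%N) -> mcvg u a -> mcvg (u \o f) a.
Proof. by move=> hf ua i j; apply: cvg_subsequence hf (ua i j). Qed.

Lemma mcvg_dotv n (u : nat -> 'M[R]_n) a x y :
  mcvg u a -> (fun k => dotv x (u k *m y)) @ \oo --> dotv x (a *m y).
Proof. by move=> ua; apply: mcvgM; [apply: mcvg_cst|apply: mcvgM => //; apply: mcvg_cst]. Qed.

Lemma mcvg_entrysum p q (u : nat -> 'M[R]_(p, q)) a :
  mcvg u a -> (fun k => entrysum (u k)) @ \oo --> entrysum a.
Proof.
by move=> ua; apply: cvg_bigsum => i _; apply: cvg_bigsum => j _; apply: cvg_norm.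
Qed.

Lemma cvg_ge_lim (u : nat -> R) l c : (forall k, c <= u k) -> u @ \oo --> l -> c <= l.
Proof. by move=> h ul; apply: (cvgr_to_ge ul); near=> k. Unshelve. all: end_near. Qed.

Lemma norm_entry_le p q (M : 'M[R]_(p, q)) i j : `|M i j| <= `|M|.
Proof. by rewrite [in leRHS]/Num.norm /= mx_normrE (le_bigmax _ (fun ij => `|M ij.1 ij.2|) (i, j)). Qed.

Lemma mcvg_of_dist p q (u : nat -> 'M[R]_(p, q)) a :
  (forall k, `|u k - a| < k.+1%:R^-1) -> mcvg u a.
Proof.
move=> h i j; apply/cvgrPdist_lt => e e0.
have : \forall k \near \oo, (k.+1%:R^-1 : R) < e.
  have /cvgrPdist_lt/(_ e e0) := @cvg_harmonic R.
  by apply: filterS => k; rewrite /= sub0r normrN ger0_norm.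
apply: filterS => k /=; apply: le_lt_trans; rewrite distrC.
have := norm_entry_le (u k - a) i j; rewrite !mxE => /le_trans; apply.
exact: ltW.
Qed.

(** Bolzano-Weierstrass one coordinate at a time: each extraction keeps the limits already obtained.
    Only [n <= f n] is recorded of the extraction, which is enough to transport limits at
    infinity. *)
Lemma bounded_subsequence (I : Type) (s : seq I) (u : I -> nat -> R) :
  (forall i, exists M, forall k, `|u i k| <= M) ->
  exists f : nat -> nat, (forall n, (n <= f n)%N) /\
    forall i, List.In i s -> exists l : R, u i \o f @ \oo --> l.
Proof.
move=> bu; elim: s => [|i s [f [hf cf]]]; first by exists id.
have bf : bounded_fun (u i \o f).
  have [M hM] := bu i; exists M; split; first exact: num_real.
  by move=> x Mx k _; apply: le_trans (hM _) (ltW Mx).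
have [g /increasing_seqP ig cg] := bolzano_weierstrass bf.
have hg n : (n <= g n)%N.
  by elim: n => // n IH; apply: leq_ltn_trans IH (ig n).
exists (f \o g); split=> [n|j]; first exact: leq_trans (hg n) (hf _).
case=> [<-|/cf[l hl]]; last by exists l; apply: (cvg_subsequence hg hl).
by exists (lim (u i \o f \o g @ \oo)).
Qed.

Lemma mcvg_bounded_subsequence p q (u : nat -> 'M[R]_(p, q)) M :
  (forall k i j, `|u k i j| <= M) ->
  exists f l, (forall n, (n <= f n)%N) /\ mcvg (u \o f) l.
Proof.
move=> hM.
have [|f [hf cf]] := @bounded_subsequence _ (enum {: 'I_p * 'I_q})
  (fun ij k => u k ij.1 ij.2); first by move=> ij; exists M.
have InP (T : eqType) (x : T) (s : seq T) : x \in s -> List.In x s.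
  by elim: s => // y s IH; rewrite inE => /orP[/eqP->|/IH]; [left|right].
have {}cf ij := cf ij (InP _ _ _ (mem_enum _ ij)).
have [l hl] := choice cf.
by exists f, (\matrix_(i, j) l (i, j)); split=> // i j; rewrite mxE; apply: hl.
Qed.

Definition ccvg (u : nat -> R[i]) (l : R[i]) :=
  (fun k => complex.Re (u k)) @ \oo --> complex.Re l /\
  (fun k => complex.Im (u k)) @ \oo --> complex.Im l.

Lemma ccvgD u v a b : ccvg u a -> ccvg v b -> ccvg (fun k => u k + v k) (a + b).
Proof.
case=> ur ui [vr vi]; split.
  rewrite raddfD /=; under eq_fun do rewrite raddfD /=; exact: cvgD.
rewrite raddfD /=; under eq_fun do rewrite raddfD /=; exact: cvgD.
Qed.

Lemma ccvgM u v a b : ccvg u a -> ccvg v b -> ccvg (fun k => u k * v k) (a * b).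
Proof.
have reM (x y : R[i]) : complex.Re (x * y) =
    complex.Re x * complex.Re y - complex.Im x * complex.Im y by case: x y => ? ? [].
have imM (x y : R[i]) : complex.Im (x * y) =
    complex.Re x * complex.Im y + complex.Im x * complex.Re y by case: x y => ? ? [].
case=> ur ui [vr vi]; split.
  rewrite reM; under eq_fun do rewrite reM.
  by apply: cvgB; apply: cvgM.
rewrite imM; under eq_fun do rewrite imM.
by apply: cvgD; apply: cvgM.
Qed.

Lemma ccvg_det n (M : nat -> 'M[R[i]]_n) (L : 'M[R[i]]_n) :
  (forall i j, ccvg (fun k => M k i j) (L i j)) -> ccvg (fun k => \det (M k)) (\det L).
Proof.
have cst c : ccvg (fun=> c) c by split; apply: cvg_cst.
move=> h; rewrite /determinant.
elim: (index_enum _) => [|s r IH].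
  by rewrite big_nil; under eq_fun do rewrite big_nil; apply: cst.
rewrite big_cons; under eq_fun do rewrite big_cons.
apply: ccvgD => //; apply: ccvgM; first exact: cst.
elim: (index_enum _) => [|i t IHt].
  by rewrite big_nil; under eq_fun do rewrite big_nil; apply: cst.
rewrite big_cons; under eq_fun do rewrite big_cons.
exact: ccvgM.
Qed.

Lemma horner_char_poly n (M : 'M[R[i]]_n) z : (char_poly M).[z] = \det (z%:M - M).
Proof.
rewrite -[LHS]/(horner_eval z _) /char_poly -det_map_mx; congr (\det _).
by apply/matrixP => i j; rewrite !mxE /= /horner_eval hornerD hornerN hornerC hornerMn hornerX.
Qed.

(** At a root [z] of the limit with positive real part [a], [det (z - F k)] tends to 0 while its
    squared modulus stays above [(a^n)^2]. *)
Lemma hurwitz_limit n (F : nat -> 'M[R]_n) L z : (forall k, hurwitz (F k)) ->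
  mcvg F L -> root (map_poly (@CR R) (char_poly L)) z -> complex.Re z <= 0.
Proof.
case: z => a b hF FL; rewrite map_char_polyCR /root horner_char_poly => /eqP det0.
rewrite leNgt /=; apply/negP => a0.
have [dr di] : ccvg (fun k => \det ((Complex a b)%:M - map_mx (@CR R) (F k))) 0.
  rewrite -det0; apply: ccvg_det => i j; rewrite !mxE.
  split; rewrite raddfB /=; under eq_fun do rewrite !mxE raddfB /=.
    by apply: cvgB; [apply: cvg_cst|apply: FL].
  by apply: cvgB; apply: cvg_cst.
have h0 := cvgD (cvgM dr dr) (cvgM di di); rewrite mulr0 addr0 in h0.
suff : a ^+ n ^+ 2 <= 0 by rewrite leNgt !exprn_gt0.
apply: (cvg_ge_lim _ (h0 _ _ _)) => k.
have := hurwitz_charpoly_ge b (hF k) (ltW a0).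
by rewrite /= horner_char_poly !expr2.
Qed.

End EntrywiseLimits.
Arguments mcvg_cst {R p q} l.
Arguments mcvgZ {R p q} c {u a}.
Arguments mcvg_dotv {R n u a} x y.

(** * Limits of stabilizing solutions *)

Section RiccatiLimit.
Variable R : realType.

(** For the column [u = X v] with [v] a basis vector, the form of the equation at [v] gives
    [b c |u|^2 <= 2 |A^T v| |u|]. The coercive quadratic term thus controls [X] through [A]
    alone. *)
Lemma riccati_entry_bound n (A S X W : 'M[R]_n) b c : 0 < b -> 0 < c -> psd W ->
  (forall v, c * dotv v v <= dotv v (S *m v)) -> X^T = X ->
  A *m X + X *m A^T + b *: (X *m S *m X) + W = 0 ->
  forall i j, X i j ^+ 2 <= 4 * entrysum (A *m A^T) / (b * c) ^+ 2.
Proof.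
move=> b0 c0 /psdP[_ pW] hS sX ric i j; set v := delta_mx j 0 : 'cV[R]_n.
have vv : dotv v v = 1.
  by rewrite dotvE (bigD1 j) //= !mxE !eqxx mulr1 big1 ?addr0 // => k kj; rewrite !mxE (negPf kj) mul0r.
have -> : X i j = (X *m v) i 0.
  rewrite mxE (bigD1 j) //= mxE !eqxx mulr1 big1 ?addr0 // => k kj.
  by rewrite mxE (negPf kj) mulr0.
apply: le_trans (sqr_entry_le _ i) _; set u := X *m v.
have ricv := riccati_form v sX ric; rewrite -/u in ricv.
have bc0 : 0 < b * c by rewrite mulr_gt0.
have h1 : b * c * dotv u u <= - (2 * dotv (A^T *m v) u).
  by have := ler_wpM2l (ltW b0) (hS u); have := pW v; rewrite mulrA; lra.
rewrite ler_pdivlMr ?exprn_gt0 //.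
have h2 := dotv_sqr_le (A^T *m v) u.
have h3 := dotv_mulmx_le A^T v; rewrite trmxK vv mulr1 in h3.
have [u0|un] := eqVneq (dotv u u) 0.
  by rewrite u0 mul0r mulr_ge0 ?entrysum_ge0.
have up : 0 < dotv u u by rewrite lt_neqAle eq_sym un dotvv_ge0.
have h4 : (b * c * dotv u u) ^+ 2 <= 4 * dotv (A^T *m v) u ^+ 2.
  have l0 : 0 <= b * c * dotv u u by rewrite mulr_ge0 // ltW.
  have -> : 4 * dotv (A^T *m v) u ^+ 2 = (- (2 * dotv (A^T *m v) u)) ^+ 2 by ring.
  by rewrite ler_sqr // nnegrE (le_trans l0 h1).
have h5 : dotv u u * (dotv u u * (b * c) ^+ 2) <= dotv u u * (4 * entrysum (A *m A^T)).
  have -> : dotv u u * (dotv u u * (b * c) ^+ 2) = (b * c * dotv u u) ^+ 2 by ring.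
  have := ler_wpM2l (ltW up) h3; lra.
by rewrite ler_pM2l in h5.
Qed.

Lemma riccati_limit n (A S X : nat -> 'M[R]_n) (A0 S0 W : 'M[R]_n) b c :
  0 < b -> 0 < c -> psd W -> mcvg A A0 -> mcvg S S0 ->
  (forall k v, c * dotv v v <= dotv v (S k *m v)) ->
  (forall k, psd (X k)) ->
  (forall k, A k *m X k + X k *m (A k)^T + b *: (X k *m S k *m X k) + W = 0) ->
  (forall k, hurwitz (A k + b *: (X k *m S k))) ->
  exists X0, [/\ psd X0, A0 *m X0 + X0 *m A0^T + b *: (X0 *m S0 *m X0) + W = 0 &
    forall z, root (map_poly (@CR R) (char_poly (A0 + b *: (X0 *m S0)))) z ->
      complex.Re z <= 0].
Proof.
move=> b0 c0 pW AA0 SS0 hS pX ric hF.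
have [M hM] : exists M, forall k, entrysum (A k *m (A k)^T) <= M.
  have : cvgn (fun k => entrysum (A k *m (A k)^T)).
    apply/cvg_ex; eexists; apply: mcvg_entrysum.
    by apply: mcvgM AA0 (mcvgT AA0).
  move=> /cvg_seq_bounded[M [_ hM]]; exists (M + 1) => k.
  by apply: le_trans (ler_norm _) _; apply: hM => //; rewrite ltrDl.
set m := 4 * M / (b * c) ^+ 2.
have M0 : 0 <= M by apply: le_trans (hM 0%N); apply: entrysum_ge0.
have m0 : 0 <= m by rewrite divr_ge0 ?mulr_ge0 // ltW // mulr_gt0.
(* Only squares of entries are below [m]; the entries themselves are then below [m + 1]. *)
have [k i j|f [X0 [hf fX]]] := @mcvg_bounded_subsequence R n n X (m + 1).
  have /psdP[sX _] := pX k.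
  have := riccati_entry_bound b0 c0 pW (hS k) sX (ric k) i j.
  rewrite -real_normK ?num_real // => h.
  have : `|X k i j| ^+ 2 <= m.
    apply: le_trans h _; apply: ler_wpM2r; last exact: ler_wpM2l.
    by rewrite invr_ge0 exprn_ge0 // mulr_ge0 // ltW.
  have := normr_ge0 (X k i j); rewrite expr2; nra.
have Af := mcvg_subsequence hf AA0; have Sf := mcvg_subsequence hf SS0.
exists X0; split.
- apply/psdP; split.
    apply: mcvg_unique (mcvgT fX) _ => i j.
    have -> : (fun k => ((X \o f) k)^T i j) = (fun k => (X \o f) k i j).
      by apply: funext => k /=; have /psdP[-> _] := pX (f k).
    exact: fX.
  move=> v; apply: (cvg_ge_lim _ (mcvg_dotv v v fX)) => k /=.
  by have /psdP[_ ->] := pX (f k).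
- apply: (mcvg_unique _ (mcvg_cst 0)).
  have := mcvgD (mcvgD (mcvgD (mcvgM Af fX) (mcvgM fX (mcvgT Af)))
    (mcvgZ b (mcvgM (mcvgM fX Sf) fX))) (mcvg_cst W).
  by under eq_fun do rewrite /= ric.
- move=> z; refine (@hurwitz_limit R n (fun k => A (f k) + b *: (X (f k) *m S (f k))) _ _ _ _).
    by move=> k; apply: hF.
  exact: mcvgD Af (mcvgZ b (mcvgM fX Sf)).
Qed.

End RiccatiLimit.

(** * Closedness and uniqueness for stabilizing solutions *)

Section StabilizingSolutions.
Variables (R : realType) (n m : nat).
Variables (A : 'M[R]_n) (B : 'M[R]_(n, m)) (Bw Qi : 'M[R]_n) (Ri : 'M[R]_m) (beta : R).
Hypotheses (pQi : pd Qi) (pRi : pd Ri) (beta0 : 0 < beta).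
Local Notation AK := (AK A B).
Local Notation SK := (SK Qi Ri).
Local Notation Kbeta := (Kbeta A B Bw Qi Ri beta).
Local Notation sol := (stab_riccati_sol A B Bw Qi Ri beta).

Lemma beta_inv_gt0 : 0 < beta ^- 2. Proof. by rewrite invr_gt0 exprn_gt0. Qed.

Lemma SK_sym K : (SK K)^T = SK K.
Proof.
have /pdP[sQ _] := pQi; have /pdP[sR _] := pRi.
by rewrite /Defs.SK linearD /= !trmx_mul trmxK sQ sR mulmxA.
Qed.

(** The term in [Ri] only adds to the form of [Qi], so one constant serves all gains, as limits
    along a sequence of gains require. *)
Lemma SK_coercive : exists2 c, 0 < c &
  forall K v, c * dotv v v <= dotv v (SK K *m v).
Proof.
have [c c0 hc] := pd_coercive pQi; exists c => // K v.
rewrite /Defs.SK mulmxDl dotvDr -!mulmxA; apply: le_trans (hc v) _.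
have /pd_psd/psdP[_ hR] := pRi.
by rewrite lerDl dotv_tr trmxK.
Qed.

Lemma SK_sqrt K : exists2 C : 'M[R]_(n + m, n), C^T *m C = SK K &
  Tinf A B Bw Qi Ri K = transfer C (AK K) Bw.
Proof.
have [/psdP[sQ _] QQ] := sqrtmP (pd_psd pQi).
have [/psdP[sR _] RR] := sqrtmP (pd_psd pRi).
exists (col_mx (sqrtm Qi) (sqrtm Ri *m K)) => //.
by rewrite tr_col_mx mul_row_col sQ QQ trmx_mul sR !mulmxA -(mulmxA K^T) RR.
Qed.

Lemma mulmx_gram_psd p (G : 'M[R]_(n, p)) : psd (G *m G^T).
Proof.
apply/psdP; split=> [|v]; first by rewrite trmx_mul trmxK.
by rewrite -mulmxA dotv_tr dotvv_ge0.
Qed.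

Lemma mcvg_AK (K : nat -> 'M[R]_(m, n)) K0 :
  mcvg K K0 -> mcvg (fun k => AK (K k)) (AK K0).
Proof. by move=> h; apply: mcvgD (mcvg_cst A) (mcvgM (mcvg_cst B) h). Qed.

Lemma mcvg_SK (K : nat -> 'M[R]_(m, n)) K0 :
  mcvg K K0 -> mcvg (fun k => SK (K k)) (SK K0).
Proof.
move=> h; apply: mcvgD (mcvg_cst Qi) _.
exact: mcvgM (mcvgM (mcvgT h) (mcvg_cst Ri)) h.
Qed.

Lemma stab_riccati_sol_closed (K : nat -> 'M[R]_(m, n)) (X : nat -> 'M[R]_n) K0 :
  Kbeta K0 -> mcvg K K0 -> (forall k, sol (K k) (X k)) -> exists X0, sol K0 X0.
Proof.
move=> [hA hinf] KK0 hX; have [c c0 hc] := SK_coercive.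
have [||||X0 [pX0 ric0 re0]] := @riccati_limit R n _ _ X (AK K0) (SK K0)
  (Bw *m Bw^T) _ c beta_inv_gt0 c0 (mulmx_gram_psd Bw) (mcvg_AK KK0) (mcvg_SK KK0).
- by move=> k; apply: hc.
- by move=> k; have [] := hX k.
- by move=> k; have [_ []] := hX k.
- by move=> k; have [_ []] := hX k.
exists X0; split; first exact: pX0; split; first exact: ric0; move=> [a b] rz; have := re0 _ rz.
rewrite /= le_eqVlt => /orP[/eqP az|//].
have [C CE TE] := SK_sqrt K0; rewrite /hinf_norm TE in hinf.
move: rz; rewrite az -char_polyT => /root_char_polyP[x [y [h1 h2 xy]]].
have /psdP[sX0 _] := pX0; have [d d0 hd] := SK_coercive.
have pS v : v != 0 -> 0 < dotv v (C^T *m C *m v).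
  by move=> v0; rewrite CE; apply: lt_le_trans (hd K0 v); rewrite mulr_gt0 // dotvv_gt0.
rewrite -CE in ric0 h1 h2.
have := riccati_no_imaginary_eigenvalue hA beta0 pS hinf sX0 ric0 (w := b) (x := x) (y := y).
move: h1 h2; rewrite !scale0r sub0r add0r => h1 h2 /(_ h1 h2)[x0 y0].
by move: xy; rewrite x0 y0 eqxx.
Qed.

(** Subtracting the equations gives the Sylvester equation for [X - Y]. Neither solution is assumed
    symmetric: with [Y^T] in the last hypothesis, the choice [Y = X^T] later yields the symmetry of
    [X]. *)
Lemma riccati_stabilizing_unique (A1 S X Y W : 'M[R]_n) b : S^T = S ->
  A1 *m X + X *m A1^T + b *: (X *m S *m X) + W = 0 ->
  A1 *m Y + Y *m A1^T + b *: (Y *m S *m Y) + W = 0 ->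
  hurwitz (A1 + b *: (X *m S)) -> hurwitz (A1 + b *: (Y^T *m S)) -> X = Y.
Proof.
move=> sS rX rY hX hY; apply/eqP; rewrite -subr_eq0; apply/eqP.
apply: (sylvester_eq0 hX hY).
have FE : (A1 + b *: (Y^T *m S))^T = A1^T + b *: (S *m Y).
  by rewrite linearD linearZ /= trmx_mul trmxK sS.
have -> : (A1 + b *: (X *m S)) *m (X - Y) + (X - Y) *m (A1 + b *: (Y^T *m S))^T =
  (A1 *m X + X *m A1^T + b *: (X *m S *m X) + W) -
  (A1 *m Y + Y *m A1^T + b *: (Y *m S *m Y) + W); last by rewrite rX rY subrr.
rewrite FE mulmxBr !mulmxDl !mulmxDr !mulNmx -!scalemxAl -!scalemxAr !mulmxA.
move: (A1 *m X) (A1 *m Y) (X *m A1^T) (Y *m A1^T) (X *m S *m X) (X *m S *m Y) (Y *m S *m Y).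
by move=> a1 a2 a3 a4 a5 a6 a7; apply/matrixP => i j; rewrite !mxE; ring.
Qed.

Lemma XK_eq K X : sol K X -> XK A B Bw Qi Ri beta K = X.
Proof.
move=> hX; have [pY [rY hY]] : sol K (XK A B Bw Qi Ri beta K).
  by apply: (xgetPex 0); exists X.
have [pX [rX hX']] := hX; have /psdP[sX _] := pX.
apply: (riccati_stabilizing_unique (SK_sym K) rY rX hY).
by rewrite sX; apply: hX'.
Qed.

Lemma XK_eq0 K : ~ (exists X, sol K X) -> XK A B Bw Qi Ri beta K = 0.
Proof. by move=> h; apply: xgetPN => X hX; apply: h; exists X. Qed.

End StabilizingSolutions.

(** * Quadratic systems and word series *)

Section Words.
Variable J : finType.

(* Power series are indexed by words in the letters [J], as if the variables did not commute: the
   coefficients of a product are then sums over the ways of cutting a word in two. *)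
Fixpoint wsum (U : nmodType) (d : nat) (f : seq J -> U) : U :=
  if d is d'.+1 then \sum_j wsum d' (fun w => f (j :: w)) else f [::].

Lemma eq_wsum (U : nmodType) d (f g : seq J -> U) :
  (forall w, size w = d -> f w = g w) -> wsum d f = wsum d g.
Proof.
elim: d f g => [|d IH] f g h /=; first exact: h.
by apply: eq_bigr => j _; apply: IH => w sw; apply: h; rewrite /= sw.
Qed.

Lemma wsum0 (U : nmodType) d : wsum d (fun=> 0 : U) = 0.
Proof. by elim: d => //= d IH; rewrite big1. Qed.

Lemma wsum_sum (U : nmodType) d (I : Type) (r : seq I) (P : pred I) (f : I -> seq J -> U) :
  wsum d (fun w => \sum_(i <- r | P i) f i w) = \sum_(i <- r | P i) wsum d (f i).
Proof.
elim: d f => [|d IH] f //=; rewrite exchange_big /=.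
by apply: eq_bigr => j _; rewrite IH.
Qed.

Lemma wsumD (U : nmodType) d (f g : seq J -> U) :
  wsum d (fun w => f w + g w) = wsum d f + wsum d g.
Proof.
by elim: d f g => [|d IH] f g //=; rewrite -big_split /=; apply: eq_bigr => j _; rewrite IH.
Qed.

Lemma raddf_wsum (U U' : nmodType) (h : {additive U -> U'}) d (f : seq J -> U) :
  h (wsum d f) = wsum d (h \o f).
Proof. by elim: d f => [|d IH] f //=; rewrite raddf_sum; apply: eq_bigr => j _; rewrite IH. Qed.

(** The product rule for word series: a word of length [i + e] is exactly a pair of words. It is
    stated for a biadditive map so as to serve both [Q] and the product of norms. *)
Lemma wsum_split (U1 U2 U : nmodType) (Q : U1 -> U2 -> U) :
  (forall u, {morph Q u : x y / x + y}) -> (forall u, Q u 0 = 0) ->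
  (forall v, {morph Q^~ v : x y / x + y}) -> (forall v, Q 0 v = 0) ->
  forall i e f g, wsum (i + e) (fun w => Q (f (take i w)) (g (drop i w))) =
    Q (wsum i f) (wsum e g).
Proof.
move=> Qr Qr0 Ql Ql0; elim=> [|i IH] e f g /=.
  rewrite add0n (eq_wsum (g := fun w => Q (f [::]) (g w))) => [|w _]; last first.
    by rewrite take0 drop0.
  elim: e g => [|e IHe] g //=.
  rewrite (big_morph (Q _) (Qr _) (Qr0 _)); apply: eq_bigr => j _.
  by rewrite -IHe.
rewrite (big_morph (Q^~ _) (Ql _) (Ql0 _)); apply: eq_bigr => j _.
exact: (IH e (fun w => f (j :: w))).
Qed.

Lemma ler_wsum (R : numDomainType) d (f g : seq J -> R) :
  (forall w, size w = d -> f w <= g w) -> wsum d f <= wsum d g.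
Proof.
elim: d f g => [|d IH] f g h /=; first exact: h.
by apply: ler_sum => j _; apply: IH => w sw; apply: h; rewrite /= sw.
Qed.

Lemma wsum_ge0 (R : numDomainType) d (f : seq J -> R) :
  (forall w, 0 <= f w) -> 0 <= wsum d f.
Proof. by move=> h; rewrite -(wsum0 R d); apply: ler_wsum. Qed.

Lemma wsum_mulr (R : pzRingType) d (c : R) (f : seq J -> R) :
  wsum d (fun w => f w * c) = wsum d f * c.
Proof.
by elim: d f => [|d IH] f //=; rewrite mulr_suml; apply: eq_bigr => j _; rewrite IH.
Qed.

Lemma wsum_subadd (U : nmodType) (R : numDomainType) (N : U -> R) :
  N 0 = 0 -> (forall u v, N (u + v) <= N u + N v) ->
  forall d (f : seq J -> U), N (wsum d f) <= wsum d (N \o f).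
Proof.
move=> N0 ND d; elim: d => [|d IH] f //=.
apply: le_trans (_ : \sum_j N (wsum d (fun w => f (j :: w))) <= _).
  by elim/big_rec2: _ => [|j x y _ h]; rewrite ?N0 //; apply: le_trans (ND _ _) _; rewrite lerD2l.
by apply: ler_sum => j _; apply: IH.
Qed.

Definition mono (R : pzRingType) (k : J -> R) (w : seq J) : R := \prod_(j <- w) k j.

Lemma mono_split (R : pzRingType) (k : J -> R) i w :
  mono k w = mono k (take i w) * mono k (drop i w).
Proof. by rewrite /mono -big_cat cat_take_drop. Qed.

Lemma mono_norm_le (R : numDomainType) (k : J -> R) t w : 0 <= t ->
  (forall j, `|k j| <= t) -> `|mono k w| <= t ^+ size w.
Proof.
move=> t0 h; elim: w => [|j w IH]; rewrite /mono ?big_nil ?normr1 //.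
by rewrite big_cons normrM exprS ler_pM.
Qed.

End Words.

(** Both sides run over the pairs with [i + e < D], by diagonals and by rows. *)
Lemma cauchy_partial_sum (U : nmodType) (F : nat -> nat -> U) D :
  \sum_(d < D) \sum_(i < d.+1) F i (d - i)%N = \sum_(i < D) \sum_(e < D - i) F i e.
Proof.
elim: D => [|D IH]; first by rewrite !big_ord0.
rewrite big_ord_recr /= IH [RHS]big_ord_recr /= subSnn big_ord1.
have -> : \sum_(i < D) \sum_(e < D.+1 - i) F i e =
    \sum_(i < D) \sum_(e < D - i) F i e + \sum_(i < D) F i (D - i)%N.
  rewrite -big_split; apply: eq_bigr => i _.
  by rewrite subSn 1?ltnW // big_ord_recr.
by rewrite -addrA big_ord_recr /= subnn.
Qed.

Import VectorInternalTheory.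

(** * Power series solution of [y = a(k) + Q(y, y)] *)

Section QuadraticSystem.
Variables (R : realType) (J : finType) (V : vectType R).
Variables (a : J -> V) (Q : V -> V -> V).
Hypotheses (Qr : forall u, linear (Q u)) (Ql : forall v, linear (Q^~ v)).

Lemma quadrDr u : {morph Q u : x y / x + y}.
Proof. by move=> x y; have := Qr u 1 x y; rewrite !scale1r. Qed.
Lemma quadrDl v : {morph Q^~ v : x y / x + y}.
Proof. by move=> x y; have := Ql v 1 x y; rewrite !scale1r. Qed.
Lemma quadr0r u : Q u 0 = 0.
Proof. by have := Qr u (-1) 0 0; rewrite scaler0 addr0 scaleN1r addNr. Qed.
Lemma quadr0l v : Q 0 v = 0.
Proof. by have := Ql v (-1) 0 0; rewrite scaler0 addr0 scaleN1r addNr. Qed.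
Lemma quadrZr c u v : Q u (c *: v) = c *: Q u v.
Proof. by have := Qr u c v 0; rewrite quadr0r !addr0. Qed.
Lemma quadrZl c u v : Q (c *: u) v = c *: Q u v.
Proof. by have := Ql v c u 0; rewrite quadr0l !addr0. Qed.

Let coo (v : V) i : R := v2r v 0 i.
(** [V] is merely a finite-dimensional space; its norm is the sum of absolute coordinates in the
    basis behind [v2r]. *)
Let cnorm (v : V) : R := \sum_i `|coo v i|.
Let e_ i : V := r2v (delta_mx 0 i).

Lemma coo_basis v : v = \sum_i coo v i *: e_ i.
Proof.
by rewrite -[v in LHS]v2rK {1}(row_sum_delta (v2r v)) linear_sum; apply: eq_bigr => i _;
   rewrite linearZ.
Qed.

Lemma cnorm0 : cnorm 0 = 0.
Proof. by rewrite /cnorm big1 // => i _; rewrite /coo linear0 mxE normr0. Qed.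

Lemma cnorm_ge0 v : 0 <= cnorm v. Proof. exact: sumr_ge0. Qed.

Lemma cnormD u v : cnorm (u + v) <= cnorm u + cnorm v.
Proof.
by rewrite /cnorm -big_split; apply: ler_sum => i _; rewrite /coo linearD mxE ler_normD.
Qed.

Lemma cnormZ c v : cnorm (c *: v) = `|c| * cnorm v.
Proof.
by rewrite /cnorm mulr_sumr; apply: eq_bigr => i _; rewrite /coo linearZ mxE normrM.
Qed.

Lemma cnorm_sum (I : Type) (r : seq I) (P : pred I) (f : I -> V) :
  cnorm (\sum_(i <- r | P i) f i) <= \sum_(i <- r | P i) cnorm (f i).
Proof.
elim/big_rec2: _ => [|i x y _ h]; first by rewrite cnorm0.
by apply: le_trans (cnormD _ _) _; rewrite lerD2l.
Qed.

Lemma coo_le v i : `|coo v i| <= cnorm v.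
Proof. by rewrite /cnorm (bigD1 i) //= lerDl sumr_ge0. Qed.

Let quadnorm : R := \sum_k \sum_l cnorm (Q (e_ k) (e_ l)).

Lemma quad_coo u v : Q u v = \sum_k \sum_l (coo u k * coo v l) *: Q (e_ k) (e_ l).
Proof.
rewrite [u in LHS]coo_basis (big_morph _ (quadrDl v) (quadr0l v)).
apply: eq_bigr => k _; rewrite quadrZl [v in LHS]coo_basis.
rewrite (big_morph _ (quadrDr _) (quadr0r _)) scaler_sumr.
by apply: eq_bigr => l _; rewrite quadrZr scalerA.
Qed.

Lemma cnorm_quad u v : cnorm (Q u v) <= quadnorm * (cnorm u * cnorm v).
Proof.
rewrite quad_coo /quadnorm mulr_suml; apply: le_trans (cnorm_sum _ _ _) _; apply: ler_sum => k _.
rewrite mulr_suml; apply: le_trans (cnorm_sum _ _ _) _; apply: ler_sum => l _.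
by rewrite cnormZ mulrC ler_wpM2l ?cnorm_ge0 // normrM ler_pM ?coo_le.
Qed.

Lemma quadnorm_ge0 : 0 <= quadnorm.
Proof. by apply: sumr_ge0 => k _; apply: sumr_ge0 => l _; apply: cnorm_ge0. Qed.

(** The word coefficients of the iterates of [y -> a(k) + Q(y, y)] started at 0. The cuts at both
    ends of [w] are kept in the sum; they vanish because the empty word has coefficient 0, so only
    strictly shorter words contribute. *)
Fixpoint picard k (w : seq J) : V :=
  if k is k'.+1 then (if w is [:: j] then a j else 0) +
    \sum_(i < (size w).+1) Q (picard k' (take i w)) (picard k' (drop i w))
  else 0.

Lemma picard_nil k : picard k [::] = 0.
Proof. by elim: k => //= k IH; rewrite big_ord1 IH quadr0l addr0. Qed.

(* A word of length [d] receives its final coefficient at step [d] of the iteration. *)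
Lemma picard_stable k l w : (size w <= k)%N -> (size w <= l)%N -> picard k w = picard l w.
Proof.
elim: k l w => [|k IH] [|l] w; rewrite ?leqn0.
- by [].
- by move=> /nilP->; rewrite !picard_nil.
- by move=> _ /nilP->; rewrite !picard_nil.
move=> wk wl /=; congr (_ + _); apply: eq_bigr => -[i /= iw] _.
case: (posnP i) => [->|i0]; first by rewrite take0 !picard_nil !quadr0l.
move: iw; rewrite ltnS leq_eqVlt => /orP[/eqP->|iw].
  by rewrite drop_size !picard_nil !quadr0r.
have st : size (take i w) = i by rewrite size_take iw.
have sd : (size (drop i w) < size w)%N by rewrite size_drop ltn_subrL i0 (leq_ltn_trans _ iw).
congr (Q _ _); apply: IH; rewrite ?st.
- by rewrite -ltnS (leq_trans iw).
- by rewrite -ltnS (leq_trans iw).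
- by rewrite -ltnS (leq_trans sd).
- by rewrite -ltnS (leq_trans sd).
Qed.

Definition wcoef (w : seq J) : V := picard (size w) w.

Lemma wcoefE w : wcoef w = (if w is [:: j] then a j else 0) +
  \sum_(i < (size w).+1) Q (wcoef (take i w)) (wcoef (drop i w)).
Proof.
rewrite /wcoef (picard_stable (l := (size w).+1)) //= ; congr (_ + _).
apply: eq_bigr => i _; congr (Q _ _); apply: picard_stable => //.
  by rewrite size_take; case: ltnP => // /ltnW.
by rewrite size_drop leq_subr.
Qed.

Let wnorm d := wsum d (cnorm \o wcoef).
Let linnorm := \sum_j cnorm (a j).

Lemma wnorm_ge0 d : 0 <= wnorm d. Proof. by apply: wsum_ge0 => w; apply: cnorm_ge0. Qed.
Lemma wnorm0 : wnorm 0 = 0. Proof. by rewrite /wnorm /= /wcoef /= cnorm0. Qed.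
Lemma linnorm_ge0 : 0 <= linnorm. Proof. by apply: sumr_ge0 => j _; apply: cnorm_ge0. Qed.

Lemma wsum_single (W : nmodType) d (f : J -> W) :
  wsum d (fun w => if w is [:: j] then f j else 0) = if d == 1 then \sum_j f j else 0.
Proof.
case: d => [|[|d]] //=; apply: big1 => j _; apply: big1 => k _.
exact: wsum0.
Qed.

(** The norms in degree [d] obey the recursion of the scalar equation
    [s = linnorm t + quadnorm s^2], with an inequality. *)
Lemma wnorm_le d : wnorm d <= (if d == 1 then linnorm else 0) + quadnorm * \sum_(i < d.+1) wnorm i * wnorm (d - i).
Proof.
rewrite /wnorm /linnorm -(wsum_single d (cnorm \o a)).
have -> : \sum_(i < d.+1) wsum i (cnorm \o wcoef) * wsum (d - i) (cnorm \o wcoef) =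
    wsum d (fun w => \sum_(i < d.+1) cnorm (wcoef (take i w)) * cnorm (wcoef (drop i w))).
  rewrite wsum_sum; apply: eq_bigr => -[i /= id] _.
  rewrite -(wsum_split (Q := *%R)) ?subnKC //; last 2 first.
  - by move=> u x y; rewrite mulrDl.
  - exact: mul0r.
  - by move=> u x y; rewrite mulrDr.
  - exact: mulr0.
rewrite [quadnorm * _]mulrC -wsum_mulr -wsumD; apply: ler_wsum => w wd /=.
rewrite wcoefE; apply: le_trans (cnormD _ _) _; apply: lerD.
  by case: w {wd} => [|j [|]]; rewrite ?cnorm0.
rewrite wd mulr_suml; apply: le_trans (cnorm_sum _ _ _) _; apply: ler_sum => i _.
by rewrite mulrC cnorm_quad.
Qed.

(* The radius makes [quadnorm * bound ^+ 2 <= linnorm * radius], which is what keeps the partial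
   sums of coefficient norms below [bound]. *)
Let radius : R := (4 * quadnorm * linnorm + 1)^-1.
Let bound : R := 2 * linnorm * radius.

Lemma radius_gt0 : 0 < radius.
Proof. by rewrite invr_gt0 ltr_wpDl // !mulr_ge0 ?quadnorm_ge0 ?linnorm_ge0. Qed.

Lemma bound_ge0 : 0 <= bound.
Proof. by rewrite !mulr_ge0 ?linnorm_ge0 // ltW // radius_gt0. Qed.

(** Since [wnorm 0 = 0], the convolution up to degree [D] involves only terms of degree below [D].
    Each partial sum is thus at most [linnorm * radius] plus [quadnorm] times the square of the
    previous one, and [bound] is preserved by this step. *)
Lemma wnorm_partial_sum D : \sum_(d < D) wnorm d * radius ^+ d <= bound.
Proof.
have t00 := radius_gt0; have x0 d : 0 <= wnorm d * radius ^+ d by rewrite mulr_ge0 ?wnorm_ge0 ?exprn_ge0 ?ltW.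
elim: D => [|D IH]; first by rewrite big_ord0 bound_ge0.
set x := fun d => wnorm d * radius ^+ d.
have S0 : 0 <= \sum_(i < D) x i by apply: sumr_ge0 => i _; apply: x0.
apply: le_trans (_ : linnorm * radius + quadnorm * (\sum_(i < D) x i) ^+ 2 <= _); last first.
  have h1 : (\sum_(i < D) x i) ^+ 2 <= bound ^+ 2 by rewrite ler_sqr ?nnegrE ?bound_ge0.
  have h2 : quadnorm * bound ^+ 2 <= linnorm * radius.
    have -> : quadnorm * bound ^+ 2 = (4 * quadnorm * linnorm * radius) * (linnorm * radius) by rewrite /bound; ring.
    have d0 : 0 < 4 * quadnorm * linnorm + 1 by rewrite ltr_wpDl // !mulr_ge0 ?quadnorm_ge0 ?linnorm_ge0.
    apply: ler_piMl; first by rewrite mulr_ge0 ?linnorm_ge0 ?ltW.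
    by rewrite /radius ler_pdivrMr // mul1r lerDl.
  by have := ler_wpM2l quadnorm_ge0 h1; rewrite /bound in h2 *; lra.
apply: le_trans (_ : \sum_(d < D.+1) ((if d == 1 :> nat then linnorm * radius else 0) +
    quadnorm * \sum_(i < d.+1) x i * x (d - i)%N) <= _).
  apply: ler_sum => -[d /= _] _; have h := wnorm_le d.
  rewrite -(ler_pM2r (exprn_gt0 d t00)) in h; apply: le_trans h _.
  rewrite mulrDl -[quadnorm * _ * _]mulrA [(\sum_(_ < d.+1) _) * _]mulr_suml; apply: lerD.
    by case: eqP => [->|]; rewrite ?expr1 ?mul0r.
  apply: ler_wpM2l; first exact: quadnorm_ge0.
  apply: ler_sum => -[i /= id] _; rewrite /x -[in radius ^+ d](subnKC (_ : i <= d)%N) //.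
  by rewrite exprD le_eqVlt; apply/orP; left; apply/eqP; ring.
rewrite big_split /= -mulr_sumr (cauchy_partial_sum (fun i e => x i * x e)).
apply: lerD.
  case: D {IH S0} => [|D]; first by rewrite big_ord1 /= mulr_ge0 ?linnorm_ge0 ?ltW.
  rewrite (bigD1 (inord 1)) //= inordK // eqxx big1 ?addr0 // => i.
  by rewrite -val_eqE /= inordK // => /negPf->.
apply: ler_wpM2l; first exact: quadnorm_ge0.
rewrite big_ord_recr /= subSnn big_ord1 [x 0%N]/x wnorm0 mul0r mulr0 addr0.
rewrite expr2 mulr_suml; apply: ler_sum => -[i /= iD] _.
rewrite -mulr_sumr.
case: (posnP i) => [->|i0]; first by rewrite /x wnorm0 !mul0r.
apply: ler_wpM2l; first exact: x0.
rewrite -[leRHS](big_mkord xpredT) -[leLHS](big_mkord xpredT).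
rewrite [leRHS](@big_cat_nat _ _ _ (D.+1 - i)) //=; last by rewrite leq_subLR addnC -addn1 leq_add2l.
by rewrite lerDl; apply: sumr_ge0 => e _; apply: x0.
Qed.

Lemma wnorm_term_le d : wnorm d * (radius / 2) ^+ d <= bound * 2^-1 ^+ d.
Proof.
rewrite exprMn mulrA ler_wpM2r ?exprn_ge0 //.
apply: le_trans (wnorm_partial_sum d.+1); rewrite big_ord_recr /= lerDr sumr_ge0 // => i _.
by rewrite mulr_ge0 ?wnorm_ge0 ?exprn_ge0 ?ltW ?radius_gt0.
Qed.

Let hom (k : J -> R) d : V := wsum d (fun w => mono k w *: wcoef w).

Lemma hom_le k t d : 0 <= t -> (forall j, `|k j| <= t) -> cnorm (hom k d) <= wnorm d * t ^+ d.
Proof.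
move=> t00 hk; apply: le_trans (wsum_subadd cnorm0 cnormD _ _) _; rewrite -wsum_mulr.
apply: ler_wsum => w wd /=; rewrite cnormZ mulrC ler_wpM2l ?cnorm_ge0 // -wd.
exact: mono_norm_le.
Qed.

Lemma homE k d : hom k d = (if d == 1 then \sum_j k j *: a j else 0) +
  \sum_(i < d.+1) Q (hom k i) (hom k (d - i)).
Proof.
rewrite -(wsum_single d (fun j => k j *: a j)).
have -> : \sum_(i < d.+1) Q (hom k i) (hom k (d - i)) =
    wsum d (fun w => \sum_(i < d.+1) Q (mono k (take i w) *: wcoef (take i w))
      (mono k (drop i w) *: wcoef (drop i w))).
  rewrite wsum_sum; apply: eq_bigr => -[i /= id] _.
  by rewrite -(wsum_split quadrDr quadr0r quadrDl quadr0l) subnKC.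
rewrite -wsumD; apply: eq_wsum => w wd; rewrite wcoefE scalerDr wd; congr (_ + _).
  case: w {wd} => [|j [|? ?]]; rewrite ?scaler0 //.
  by rewrite /mono big_seq1.
rewrite scaler_sumr; apply: eq_bigr => i _.
by rewrite quadrZl quadrZr scalerA -mono_split.
Qed.

Lemma hom_partial_sum k D : (1 < D)%N -> \sum_(d < D) hom k d =
  \sum_j k j *: a j + \sum_(i < D) \sum_(e < D - i) Q (hom k i) (hom k e).
Proof.
move=> D1; under eq_bigr do rewrite homE.
rewrite big_split /= (cauchy_partial_sum (fun i e => Q (hom k i) (hom k e))).
congr (_ + _); case: D D1 => [|[|D]] // _.
rewrite (bigD1 (inord 1)) //= inordK // eqxx [X in _ + X]big1 ?addr0 // => i.
by rewrite -val_eqE /= inordK // => /negPf->.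
Qed.

(** Degrees below [D] cancel, and what is left is the sum of [Q (hom k i) (hom k e)] with
    [i, e < D <= i + e]. At half the radius each such term carries a factor [2^-(i + e) <= 2^-D].
    The condition [1 < D] puts the linear term inside the partial sum. *)
Lemma hom_residual k D s : (1 < D)%N -> (forall j, `|k j| <= radius / 2) ->
  s = \sum_(d < D) hom k d ->
  cnorm (\sum_j k j *: a j + Q s s - s) <= quadnorm * bound ^+ 2 * 2^-1 ^+ D.
Proof.
move=> D1 hk sE; have t00 := radius_gt0.
set x := fun d => wnorm d * radius ^+ d.
have x0 d : 0 <= x d by rewrite mulr_ge0 ?wnorm_ge0 ?exprn_ge0 ?ltW.
have cnorm_hom d : cnorm (hom k d) <= x d * 2^-1 ^+ d.
  by rewrite /x -mulrA -exprMn; apply: hom_le => //; rewrite divr_ge0 // ltW.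
have -> : \sum_j k j *: a j + Q s s - s =
    \sum_(i < D) \sum_(D - i <= e < D) Q (hom k i) (hom k e).
  rewrite [X in _ - X]sE hom_partial_sum // opprD addrACA subrr add0r.
  rewrite sE (big_morph _ (quadrDl _) (quadr0l _)) -sumrB; apply: eq_bigr => i _.
  rewrite (big_morph _ (quadrDr _) (quadr0r _)).
  rewrite -(big_mkord xpredT (fun e => Q (hom k i) (hom k e))).
  rewrite -(big_mkord xpredT (fun e => Q (hom k i) (hom k e))).
  rewrite [X in X - _](@big_cat_nat _ _ _ (D - i)) //= ?leq_subr //.
  by rewrite addrAC subrr add0r.
apply: le_trans (_ : \sum_(i < D) \sum_(e < D) quadnorm * (x i * x e * 2^-1 ^+ D) <= _).
  apply: le_trans (cnorm_sum _ _ _) _; apply: ler_sum => -[i /= iD] _.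
  rewrite -(big_mkord xpredT (fun e => quadnorm * (x i * x e * 2^-1 ^+ D))).
  rewrite [leRHS](@big_cat_nat _ _ _ (D - i)) //= ?leq_subr //.
  apply: le_trans (cnorm_sum _ _ _) _; rewrite -[leLHS]add0r; apply: lerD.
    apply: sumr_ge0 => e _.
    by rewrite mulr_ge0 ?quadnorm_ge0 // mulr_ge0 ?exprn_ge0 // mulr_ge0.
  apply: ler_sum_nat => e /andP[De _].
  apply: le_trans (cnorm_quad _ _) _; apply: ler_wpM2l; first exact: quadnorm_ge0.
  apply: le_trans (ler_pM (cnorm_ge0 _) (cnorm_ge0 _) (cnorm_hom i) (cnorm_hom e)) _.
  have -> : x i * 2^-1 ^+ i * (x e * 2^-1 ^+ e) = x i * x e * 2^-1 ^+ (i + e).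
    by rewrite exprD; ring.
  apply: ler_wpM2l; first exact: mulr_ge0.
  by rewrite ler_wiXn2l // ?invf_le1 // ?ler1n // -leq_subLR.
have -> : \sum_(i < D) \sum_(e < D) quadnorm * (x i * x e * 2^-1 ^+ D) =
    quadnorm * (\sum_(i < D) x i) ^+ 2 * 2^-1 ^+ D.
  transitivity (\sum_(i < D) x i * (quadnorm * (\sum_(e < D) x e) * 2^-1 ^+ D)).
    apply: eq_bigr => i _; rewrite -mulr_sumr -mulr_suml -mulr_sumr; ring.
  rewrite -mulr_suml; ring.
rewrite ler_wpM2r ?exprn_ge0 // ler_wpM2l ?quadnorm_ge0 // ler_sqr ?nnegrE ?bound_ge0 ?sumr_ge0 //.
exact: wnorm_partial_sum.
Qed.

Lemma hom_cvg k i : (forall j, `|k j| <= radius / 2) ->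
  cvgn (fun D => \sum_(d < D) coo (hom k d) i).
Proof.
move=> hk.
have -> : (fun D => \sum_(d < D) coo (hom k d) i) = series (fun d => coo (hom k d) i).
  by apply: funext => D; rewrite /series /= big_mkord.
apply: (@normed_cvg R R^o).
apply: (@series_le_cvg _ _ (geometric bound 2^-1)) => [d|d|d|].
- exact: normr_ge0.
- by rewrite /= mulr_ge0 ?bound_ge0 ?exprn_ge0.
- apply: le_trans (coo_le _ _) _; apply: le_trans (wnorm_term_le d).
  by apply: hom_le => //; rewrite divr_ge0 // ltW // radius_gt0.
- by apply: is_cvg_geometric_series; rewrite ger0_norm // invf_lt1 // ltr1n.
Qed.

Let solution (k : J -> R) : V :=
  r2v (\row_i limn (fun D => \sum_(d < D) coo (hom k d) i)).

Lemma coo_solution k i : (forall j, `|k j| <= radius / 2) ->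
  (fun D => \sum_(d < D) coo (hom k d) i) @ \oo --> coo (solution k) i.
Proof. by move=> hk; rewrite /coo r2vK mxE; apply: hom_cvg. Qed.

Lemma coo_sum (I : Type) (r : seq I) (P : pred I) (f : I -> V) i :
  coo (\sum_(d <- r | P d) f d) i = \sum_(d <- r | P d) coo (f d) i.
Proof. by rewrite /coo linear_sum summxE. Qed.

Lemma solution_eq k : (forall j, `|k j| <= radius / 2) ->
  solution k = \sum_j k j *: a j + Q (solution k) (solution k).
Proof.
move=> hk; apply: (can_inj v2rK); apply/rowP => i.
set s := fun D => \sum_(d < D) hom k d.
have sl j : (fun D => coo (s D) j) @ \oo --> coo (solution k) j.
  by under eq_fun do rewrite coo_sum; apply: coo_solution.
have Qs : (fun D => coo (\sum_j k j *: a j + Q (s D) (s D)) i) @ \oo -->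
    coo (\sum_j k j *: a j + Q (solution k) (solution k)) i.
  rewrite /coo linearD mxE; under eq_fun do rewrite linearD mxE.
  apply: cvgD; first exact: cvg_cst.
  rewrite -/(coo _ i) quad_coo coo_sum.
  under eq_fun do rewrite -/(coo _ i) quad_coo coo_sum.
  apply: cvg_bigsum => c _; rewrite coo_sum; under eq_fun do rewrite coo_sum.
  apply: cvg_bigsum => l _; rewrite /coo linearZ mxE.
  under eq_fun do rewrite /coo linearZ mxE.
  by apply: cvgMl; apply: cvgM; apply: sl.
have D0 : (fun D => coo (\sum_j k j *: a j + Q (s D) (s D) - s D) i) @ \oo --> (0 : R).
  apply/cvgr0Pnorm_le => e e0.
  have /cvgr0Pnorm_le/(_ e e0) : (fun D => quadnorm * bound ^+ 2 * 2^-1 ^+ D) @ \oo --> (0 : R).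
    by apply: cvg_geometric; rewrite ger0_norm // invf_lt1 // ltr1n.
  have : \forall D \near \oo, (1 < D)%N by exists 2%N.
  apply: filterS2 => D D1 /=; apply: le_trans.
  apply: le_trans (ler_norm _).
  exact: le_trans (coo_le _ _) (hom_residual D1 hk erefl).
have hl : (fun D => coo (\sum_j k j *: a j + Q (s D) (s D)) i) @ \oo --> coo (solution k) i.
  have := cvgD D0 (sl i); rewrite add0r.
  have -> : (fun D => coo (\sum_j k j *: a j + Q (s D) (s D) - s D) i) +
      (fun D => coo (s D) i) = (fun D => coo (\sum_j k j *: a j + Q (s D) (s D)) i).
    by apply: funext => D; rewrite [LHS]/GRing.add /= /coo -[RHS](subrK (v2r (s D) 0 i)) linearB !mxE.
  by apply.
exact: cvg_unique hl Qs.
Qed.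

(** The series has no constant term, so one factor [t] can be taken out of every degree. This linear
    bound later makes the solution of the Riccati equation continuous at the base gain. *)
Lemma coo_solution_le k t i : 0 <= t <= radius / 2 -> (forall j, `|k j| <= t) ->
  `|coo (solution k) i| <= bound / radius * t.
Proof.
move=> /andP[tge tle] hk; have t00 := radius_gt0.
have hk2 j : `|k j| <= radius / 2 by apply: le_trans tle.
have lim : (fun D => bound / radius * t - `|\sum_(d < D) coo (hom k d) i|) @ \oo -->
    bound / radius * t - `|coo (solution k) i|.
  by apply: cvgB; [apply: cvg_cst|apply: cvg_norm; apply: coo_solution].
rewrite -subr_ge0; apply: (cvg_ge_lim _ lim) => D; rewrite subr_ge0.
apply: le_trans (ler_norm_sum _ _ _) _.
apply: le_trans (_ : \sum_(d < D) (wnorm d * radius ^+ d) * (t / radius) <= _); last first.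
  have -> : bound / radius * t = bound * (t / radius) by rewrite mulrAC mulrA.
  rewrite -mulr_suml; apply: ler_wpM2r; last exact: wnorm_partial_sum.
  by rewrite divr_ge0 // ltW.
apply: ler_sum => -[d /= _] _; apply: le_trans (coo_le _ _) _.
apply: le_trans (hom_le _ tge hk) _.
case: d => [|d]; first by rewrite wnorm0 !mul0r.
have -> : wnorm d.+1 * radius ^+ d.+1 * (t / radius) = wnorm d.+1 * (radius ^+ d * t).
  by rewrite exprS; field; rewrite gt_eqF.
rewrite exprSr; apply: ler_wpM2l; first exact: wnorm_ge0.
apply: ler_wpM2r => //; apply: lerXn2r; rewrite ?nnegrE //; first exact: ltW.
by move: tle t00; move: radius => T; lra.
Qed.

(** The conclusion is stated for every linear functional because it is applied to two kinds of them:
    the nonconstant part of the cost, and the entries of the increment of [X]. *)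
Theorem quadratic_system_analytic : exists r (y : (J -> R) -> V) (g : seq J -> V),
  [/\ 0 < r,
   forall k, (forall j, `|k j| <= r) -> y k = \sum_j k j *: a j + Q (y k) (y k) &
   forall f : {linear V -> R^o}, exists C : R,
   [/\ forall d, wsum d (fun w => `|f (g w)|) * r ^+ d <= C * 2^-1 ^+ d,
    forall k, (forall j, `|k j| <= r) ->
      (fun D => \sum_(d < D) wsum d (fun w => f (g w) * mono k w)) @ \oo --> (f (y k) : R) &
    forall k t, 0 <= t <= r -> (forall j, `|k j| <= t) -> `|f (y k)| <= C * t]].
Proof.
have t00 := radius_gt0.
exists (radius / 2), solution, wcoef; split; [by rewrite divr_gt0|exact: solution_eq|move=> f].
have fE v : f v = \sum_i coo v i * f (e_ i).
  by rewrite [v in LHS]coo_basis linear_sum; apply: eq_bigr => i _; rewrite linearZ.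
set G := \sum_i `|f (e_ i)|; have G0 : 0 <= G by apply: sumr_ge0.
have fN v : `|f v| <= cnorm v * G.
  rewrite fE mulr_sumr; apply: le_trans (ler_norm_sum _ _ _) _; apply: ler_sum => i _.
  by rewrite normrM ler_wpM2r // coo_le.
(* The first summand serves the geometric majorant, the second the linear bound. *)
exists (bound * G + bound / radius * G); split=> [d|k hk|k t ht hk].
- apply: le_trans (_ : wnorm d * G * (radius / 2) ^+ d <= _).
    apply: ler_wpM2r; first by rewrite exprn_ge0 // divr_ge0 // ltW.
    by rewrite -wsum_mulr; apply: ler_wsum => w _; apply: fN.
  rewrite mulrAC; apply: le_trans (ler_wpM2r G0 (wnorm_term_le d)) _.
  rewrite mulrDl mulrAC lerDl mulr_ge0 ?exprn_ge0 //.
  by rewrite mulr_ge0 // divr_ge0 ?bound_ge0 // ltW.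
- have -> : (fun D => \sum_(d < D) wsum d (fun w => f (wcoef w) * mono k w)) =
      (fun D => \sum_i (\sum_(d < D) coo (hom k d) i) * f (e_ i)).
    apply: funext => D; under [RHS]eq_bigr do rewrite mulr_suml.
    rewrite exchange_big /=; apply: eq_bigr => d _; rewrite -fE /hom raddf_wsum.
    by apply: eq_wsum => w _ /=; rewrite linearZ mulrC.
  by rewrite fE; apply: cvg_bigsum => i _; apply: cvgMl; apply: coo_solution.
- rewrite fE; apply: le_trans (ler_norm_sum _ _ _) _.
  apply: le_trans (_ : \sum_i bound / radius * t * `|f (e_ i)| <= _).
    by apply: ler_sum => i _; rewrite normrM ler_wpM2r // coo_solution_le.
  rewrite -mulr_sumr -/G mulrDl mulrAC lerDr mulr_ge0 //; last by case/andP: ht.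
  by rewrite mulr_ge0 // bound_ge0.
Qed.

End QuadraticSystem.

(** * From word series to multivariate power series *)

Section WordsToMonomials.
Variables (R : realType) (J : finType).

Lemma size_counts (w : seq J) : size w = (\sum_j count_mem j w)%N.
Proof.
elim: w => [|a w IH] /=; first by rewrite big1.
rewrite big_split /= -IH -[LHS]add1n; congr (_ + _)%N.
by rewrite (bigD1 a) //= eqxx big1 ?addn0 // => j /negPf; rewrite eq_sym => ->.
Qed.

Lemma mono_counts (k : J -> R) (w : seq J) : mono k w = \prod_j k j ^+ count_mem j w.
Proof.
elim: w => [|a w IH]; rewrite /mono ?big_nil; first by rewrite big1.
rewrite big_cons [X in _ * X]IH (bigD1 a) //= [RHS](bigD1 a) //= eqxx exprD mulrA.
congr (_ * _); apply: eq_bigr => j /negPf; rewrite eq_sym => ->.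
by rewrite add0n.
Qed.

Definition counts (w : seq J) : {ffun J -> nat} := [ffun j => count_mem j w].

(** Letting the letters commute: the coefficient of a monomial collects all words with the given
    letter counts, whose common length is the total degree. *)
Definition monomial_coef (f : seq J -> R) (c : {ffun J -> nat}) : R :=
  wsum (\sum_j c j)%N (fun w => if counts w == c then f w else 0).

(** Exponents below [N] have total degree at most [#|J| * N], so a finite range of word lengths
    covers the whole box. *)
Lemma box_sum N (f : seq J -> R) :
  \sum_(c : {ffun J -> 'I_N}) monomial_coef f [ffun j => c j : nat] =
  \sum_(d < (#|J| * N).+1)
    wsum d (fun w => if [forall j, count_mem j w < N]%N then f w else 0).
Proof.
transitivity (\sum_(c : {ffun J -> 'I_N}) \sum_(d < (#|J| * N).+1)
    wsum d (fun w => if counts w == [ffun j => c j : nat] then f w else 0)).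
  apply: eq_bigr => c _; rewrite /monomial_coef.
  set c' := finfun _; set s := (\sum_j _)%N.
  have sD : (s < (#|J| * N).+1)%N.
    rewrite ltnS -sum_nat_const; apply: leq_sum => j _.
    by rewrite ffunE ltnW.
  rewrite (bigD1 (Ordinal sD)) //= big1 ?addr0 // => d ds.
  apply: etrans (wsum0 J R d); apply: eq_wsum => w wd; case: eqP => // cw.
  case/eqP: ds; apply: val_inj => /=; rewrite -wd size_counts.
  by apply: eq_bigr => j _; rewrite -cw ffunE.
rewrite exchange_big /=; apply: eq_bigr => d _; rewrite -wsum_sum.
apply: eq_wsum => w _; case: ifP => [/forallP wN|/negbT].
  rewrite (bigD1 [ffun j => Ordinal (wN j)]) //= ifT; last first.
    by apply/eqP/ffunP => j; rewrite !ffunE.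
  rewrite big1 ?addr0 // => c cw; case: eqP => // e; case/eqP: cw.
  by apply/ffunP => j; apply: val_inj; rewrite ffunE /=; move/ffunP/(_ j): e; rewrite !ffunE.
rewrite negb_forall => /existsP[j]; rewrite -leqNgt => jN.
apply: big1 => c _; case: eqP => // /ffunP/(_ j); rewrite !ffunE => e.
by have := ltn_ord (c j); rewrite -e ltnNge jN.
Qed.

Lemma monomial_coefM (f : seq J -> R) (k : J -> R) (c : {ffun J -> nat}) :
  monomial_coef f c * \prod_j k j ^+ c j = monomial_coef (fun w => f w * mono k w) c.
Proof.
rewrite /monomial_coef -wsum_mulr; apply: eq_wsum => w _.
case: eqP => [<-|_]; last by rewrite mul0r.
by rewrite mono_counts; congr (_ * _); apply: eq_bigr => j _; rewrite ffunE.
Qed.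

Lemma monomial_coef_norm (f : seq J -> R) c :
  `|monomial_coef f c| <= monomial_coef (fun w => `|f w|) c.
Proof.
rewrite /monomial_coef; apply: le_trans (wsum_subadd (normr0 R) (@ler_normD _ _) _ _) _.
by apply: ler_wsum => w _ /=; case: ifP; rewrite ?normr0.
Qed.

Lemma half_geometric_sum D : \sum_(d < D) (2^-1 : R) ^+ d = 2 - 2 * 2^-1 ^+ D.
Proof.
elim: D => [|D IH]; first by rewrite big_ord0 mulr1 subrr.
by rewrite big_ord_recr /= IH exprS; field.
Qed.

End WordsToMonomials.

Section PowerSeries.
Variables (R : realType) (m n : nat) (f : seq ('I_m * 'I_n)%type -> R) (r C : R).
Hypothesis r0 : 0 < r.
Hypothesis fC : forall d, wsum d (fun w => `|f w|) * r ^+ d <= C * 2^-1 ^+ d.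
Variables (K0 K : 'M[R]_(m, n)).
Hypothesis K0K : `|K - K0| <= r.
Let J := ('I_m * 'I_n)%type.
Let k (ij : J) : R := (K - K0) ij.1 ij.2.
Let c := monomial_coef f.

Lemma majorant_ge0 : 0 <= C.
Proof. by have := fC 0; rewrite !expr0 !mulr1; apply: le_trans; apply: normr_ge0. Qed.

Lemma psumE N : psum c K0 K N = \sum_(d < (#|{: J}| * N).+1)
  wsum d (fun w => if [forall j, count_mem j w < N]%N then f w * mono k w else 0).
Proof.
rewrite -box_sum; apply: eq_bigr => a _; rewrite -monomial_coefM; congr (_ * _).
by apply: eq_bigr => ij _; rewrite ffunE.
Qed.

Lemma word_term_le (P : pred (seq J)) d :
  wsum d (fun w => if P w then `|f w * mono k w| else 0) <= C * 2^-1 ^+ d.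
Proof.
apply: le_trans (fC d); rewrite -wsum_mulr; apply: ler_wsum => w wd.
case: ifP => _; last by rewrite mulr_ge0 // exprn_ge0 // ltW.
rewrite normrM ler_wpM2l // -wd mono_norm_le ?ltW // => j.
exact: le_trans (norm_entry_le _ _ _) K0K.
Qed.

Lemma pabssum_le N : pabssum c K0 K N <= 2 * C.
Proof.
apply: le_trans (_ : \sum_(a : {ffun J -> 'I_N})
    monomial_coef (fun w => `|f w * mono k w|) [ffun j => a j : nat] <= _).
  apply: ler_sum => a _; apply: le_trans (monomial_coef_norm _ _).
  rewrite -monomial_coefM le_eqVlt; apply/orP; left; apply/eqP.
  by congr `|_ * _|; apply: eq_bigr => ij _; rewrite ffunE.
rewrite box_sum; apply: le_trans (_ : \sum_(d < (#|{: J}| * N).+1) C * 2^-1 ^+ d <= _).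
  by apply: ler_sum => d _; apply: word_term_le.
rewrite -mulr_sumr half_geometric_sum [2 * C]mulrC; apply: ler_wpM2l; first exact: majorant_ge0.
by rewrite lerBlDr lerDl mulr_ge0 // exprn_ge0.
Qed.

(** A word shorter than [N] repeats no letter [N] times, so the box contains every word of length
    below [N]. The difference is part of the tail from degree [N] on, whose geometric majorant sums
    to at most [2 C 2^-N]. *)
Lemma psum_partial_le N :
  `|psum c K0 K N - \sum_(d < N) wsum d (fun w => f w * mono k w)| <= 2 * C * 2^-1 ^+ N.
Proof.
have Cd d : `|wsum d (fun w => f w * mono k w)| <= C * 2^-1 ^+ d.
  apply: le_trans (word_term_le predT d).
  exact: wsum_subadd (normr0 R) (@ler_normD _ _) _ _.
(* Without variables the box sum has the single degree 0, and [N <= #|J| * N + 1] may fail. *)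
have [J0|Jp] := posnP #|{: J}|.
  have w0 d : (0 < d)%N -> wsum d (fun w : seq J => f w * mono k w) = 0.
    case: d => // d _ /=; apply: big1 => j _.
    by have := fintype0 j; rewrite J0.
  have nilP (w : seq J) : w = [::] by case: w => // j; have := fintype0 j; rewrite J0.
  case: N => [|N].
    rewrite big_ord0 subr0 psumE J0 mul0n big_ord1 /= expr0 mulr1.
    rewrite ifT; last by apply/forallP => j; have := fintype0 j; rewrite J0.
    by have := Cd 0; rewrite /= expr0 mulr1; have := majorant_ge0; lra.
  rewrite psumE J0 mul0n big_ord1 /= ifT; last by apply/forallP => j.
  rewrite [X in _ - X]big_ord_recl [X in _ - (_ + X)]big1 => [|i _]; last exact: w0.
  by rewrite addr0 subrr normr0 mulr_ge0 ?exprn_ge0 // mulr_ge0 ?majorant_ge0.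
have ND : (N <= (#|{: J}| * N).+1)%N by rewrite leqW // leq_pmull.
rewrite psumE; set D := (#|{: J}| * N).+1 in ND *.
rewrite -(big_mkord xpredT (fun d => wsum d (fun w => if [forall j, count_mem j w < N]%N
  then f w * mono k w else 0))).
rewrite (@big_cat_nat _ _ _ N) //= big_mkord.
have -> : \sum_(d < N) wsum d (fun w => if [forall j, count_mem j w < N]%N
    then f w * mono k w else 0) = \sum_(d < N) wsum d (fun w => f w * mono k w).
  apply: eq_bigr => d _; apply: eq_wsum => w wd; rewrite ifT //; apply/forallP => j.
  by apply: leq_ltn_trans (count_size _ _) _; rewrite wd.
rewrite addrAC subrr add0r.
apply: le_trans (_ : \sum_(N <= d < D) C * 2^-1 ^+ d <= _).
  apply: le_trans (ler_norm_sum _ _ _) _; apply: ler_sum => d _.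
  apply: le_trans (word_term_le (fun w => [forall j, count_mem j w < N]%N) d).
  apply: le_trans (wsum_subadd (normr0 R) (@ler_normD _ _) _ _) _.
  by apply: ler_wsum => w _ /=; case: ifP; rewrite ?normr0.
have : \sum_(0 <= d < D) C * 2^-1 ^+ d =
    \sum_(0 <= d < N) C * 2^-1 ^+ d + \sum_(N <= d < D) C * 2^-1 ^+ d :> R.
  by rewrite (@big_cat_nat _ _ _ N).
rewrite !big_mkord -!mulr_sumr !half_geometric_sum => e.
have := mulr_ge0 majorant_ge0 (exprn_ge0 D (_ : 0 <= 2^-1 :> R)).
rewrite invr_ge0 ler0n => /(_ erefl); move: e; set S := \sum_(N <= d < D) _; lra.
Qed.

Lemma psum_cvg (l : R) : (fun D => \sum_(d < D) wsum d (fun w => f w * mono k w)) @ \oo --> l ->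
  psum c K0 K @ \oo --> l.
Proof.
move=> hl.
have h0 : (fun N => psum c K0 K N - \sum_(d < N) wsum d (fun w => f w * mono k w))
    @ \oo --> (0 : R).
  apply/cvgr0Pnorm_le => e e0.
  have /cvgr0Pnorm_le/(_ e e0) : (fun N => 2 * C * 2^-1 ^+ N) @ \oo --> (0 : R).
    by apply: cvg_geometric; rewrite ger0_norm // invf_lt1 // ltr1n.
  apply: filterS => N /=; apply: le_trans; apply: le_trans (ler_norm _).
  exact: psum_partial_le.
have := cvgD h0 hl; rewrite add0r.
have -> : (fun N => psum c K0 K N - \sum_(d < N) wsum d (fun w => f w * mono k w)) +
  (fun D => \sum_(d < D) wsum d (fun w => f w * mono k w)) = psum c K0 K.
  by apply: funext => N; rewrite [LHS]/GRing.add /= subrK.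
by apply.
Qed.

End PowerSeries.

(** * The Riccati equation near a stabilizing solution *)

Section LinearClosure.
Variables (R : realType) (U : lmodType R).

Definition lin (V : lmodType R) (f : U -> V) : Prop := linear f.

Lemma lin_id : lin (fun x : U => x). Proof. by []. Qed.

Lemma lin_0 (V : lmodType R) : lin (fun _ : U => 0 : V).
Proof. by move=> c x y; rewrite scaler0 addr0. Qed.

Lemma lin_D (V : lmodType R) (f g : U -> V) : lin f -> lin g -> lin (fun x => f x + g x).
Proof. by move=> hf hg c x y; rewrite hf hg scalerDr addrACA. Qed.

Lemma lin_N (V : lmodType R) (f : U -> V) : lin f -> lin (fun x => - f x).
Proof. by move=> hf c x y; rewrite hf opprD scalerN. Qed.

Lemma lin_Z (V : lmodType R) b (f : U -> V) : lin f -> lin (fun x => b *: f x).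
Proof. by move=> hf c x y; rewrite hf scalerDr !scalerA mulrC. Qed.

Lemma lin_mulmxl p q s (M : 'M[R]_(p, q)) (f : U -> 'M[R]_(q, s)) :
  lin f -> lin (fun x => M *m f x).
Proof. by move=> hf c x y; rewrite hf mulmxDr -scalemxAr. Qed.

Lemma lin_mulmxr p q s (M : 'M[R]_(q, s)) (f : U -> 'M[R]_(p, q)) :
  lin f -> lin (fun x => f x *m M).
Proof. by move=> hf c x y; rewrite hf mulmxDl -scalemxAl. Qed.

Lemma lin_trmx p q (f : U -> 'M[R]_(p, q)) : lin f -> lin (fun x => (f x)^T).
Proof. by move=> hf c x y; rewrite hf linearD linearZ. Qed.

Lemma lin_app n (h : 'End('M[R]_n)) (f : U -> 'M[R]_n) : lin f -> lin (fun x => h (f x)).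
Proof. by move=> hf c x y; rewrite hf linearD linearZ. Qed.

Lemma lin_pair (V W : lmodType R) (f : U -> V) (g : U -> W) :
  lin f -> lin g -> lin (fun x => (f x, g x)).
Proof. by move=> hf hg c x y; rewrite hf hg. Qed.

Lemma lin_fst (V W : lmodType R) (f : U -> (V * W)%type) : lin f -> lin (fun x => (f x).1).
Proof. by move=> hf c x y; rewrite hf. Qed.

Lemma lin_snd (V W : lmodType R) (f : U -> (V * W)%type) : lin f -> lin (fun x => (f x).2).
Proof. by move=> hf c x y; rewrite hf. Qed.

Lemma lin_trace n (f : U -> 'M[R]_n) : lin f -> lin (fun x => \tr (f x) : R^o).
Proof. by move=> hf c x y; rewrite hf linearD linearZ. Qed.

Lemma lin_entry p q (f : U -> 'M[R]_(p, q)) i j : lin f -> lin (fun x => f x i j : R^o).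
Proof. by move=> hf c x y; rewrite hf !mxE. Qed.

End LinearClosure.

Ltac solve_lin := repeat match goal with
  | |- lin (fun x => x) => exact: lin_id
  | |- lin (fun _ => 0) => exact: lin_0
  | |- lin (fun x => (@?f x, @?g x)) => apply: (@lin_pair _ _ _ _ f g)
  | |- lin (fun x => @?f x + @?g x) => apply: (@lin_D _ _ _ f g)
  | |- lin (fun x => - @?f x) => apply: (@lin_N _ _ _ f)
  | |- lin (fun x => ?c *: @?f x) => apply: (@lin_Z _ _ _ c f)
  | |- lin (fun x => \tr (@?f x)) => apply: (@lin_trace _ _ _ f)
  | |- lin (fun x => (@?f x)^T) => apply: (@lin_trmx _ _ _ _ f)
  | |- lin (fun x => ?M *m @?f x) => apply: (@lin_mulmxl _ _ _ _ _ M f)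
  | |- lin (fun x => @?f x *m ?M) => apply: (@lin_mulmxr _ _ _ _ _ M f)
  | |- lin (fun x => (@?f x).1) => apply: (@lin_fst _ _ _ _ f)
  | |- lin (fun x => (@?f x).2) => apply: (@lin_snd _ _ _ _ f)
  | |- lin (fun x => fun_of_matrix (@?f x) ?i ?j) => apply: (@lin_entry _ _ _ _ f i j)
  | |- lin (fun x => fun_of_lfun ?h (@?f x)) => apply: (@lin_app _ _ _ h f)
  end.

(* For identities that hold once all matrix products are treated as atoms. *)
Ltac matrix_abelian := repeat (match goal with |- context [@mulmx ?r ?a ?b ?c ?M ?N] =>
  let v := fresh in set v := (@mulmx r a b c M N); clearbody v end);
  apply/matrixP => ? ?; rewrite !mxE; ring.

(** A Lyapunov matrix of [F] remains one for [G k] once the form of [(G k - F) P] is below the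
    margin [c]. *)
Lemma hurwitz_near (R : realType) n (G : nat -> 'M[R]_n) F : hurwitz F -> mcvg G F ->
  \forall k \near \oo, hurwitz (G k).
Proof.
move=> hF GF; have [P [pP [c c0 hc]]] := lyapunov hF.
have : (fun k => entrysum ((G k - F) *m P)) @ \oo --> (0 : R).
  have -> : 0 = entrysum ((F + - F) *m P).
    by rewrite subrr mul0mx /entrysum big1 // => i _; rewrite big1 // => j _; rewrite mxE normr0.
  apply: mcvg_entrysum; apply: mcvgM (mcvg_cst P).
  exact: mcvgD GF (mcvg_cst (- F)).
move=> /cvgr0Pnorm_lt/(_ c c0); apply: filterS => k; rewrite ger0_norm ?entrysum_ge0 // => hk.
apply: (hurwitz_of_lyapunov (pd_psd pP)) => v v0.
have -> : dotv v (G k *m P *m v) = dotv v (F *m P *m v) + dotv v ((G k - F) *m P *m v).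
  by rewrite !mulmxBl dotvDr dotvNr addrC subrK.
have h1 := hc v; have h2 := le_trans (ler_norm _) (qf_le ((G k - F) *m P) v).
have vv : 0 < dotv v v by rewrite dotvv_gt0.
have : entrysum ((G k - F) *m P) * dotv v v < c * dotv v v by rewrite ltr_pM2r.
by lra.
Qed.

(** * The Riccati equation as a quadratic system *)

Section LocalSolution.
Variables (R : realType) (n m : nat).
Variables (A : 'M[R]_n) (B : 'M[R]_(n, m)) (Bw Qi Q2 : 'M[R]_n) (Ri R2 : 'M[R]_m) (beta : R).
Hypotheses (pQi : pd Qi) (pRi : pd Ri) (beta0 : 0 < beta).
Variables (K0 : 'M[R]_(m, n)) (X0 : 'M[R]_n).
Hypothesis sol0 : stab_riccati_sol A B Bw Qi Ri beta K0 X0.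
Let b := beta ^- 2.
Let A0 := AK A B K0.
Let S0 := SK Qi Ri K0.
Let F0 := A0 + b *: (X0 *m S0).
(** The derivative of the Riccati map in [X] at [(K0, X0)] is [D -> F0 D + D F0^T], since [X0] and
    [S0] are symmetric. It is invertible because [F0] is Hurwitz. *)
Let Li := (sylvester_op F0)^-1%VF.

(* Increments of [(K, X, K X, K^T Ri K X, K^T R2 K X)] from their values at [K0]; in these
   variables the Riccati equation is quadratic. *)
Let V : vectType R := ('M[R]_(m, n) * 'M[R]_n * 'M[R]_(m, n) * 'M[R]_n * 'M[R]_n)%type.
Let dK (y : V) : 'M[R]_(m, n) := y.1.1.1.1.
Let dX (y : V) : 'M[R]_n := y.1.1.1.2.
Let dZ (y : V) : 'M[R]_(m, n) := y.1.1.2.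
Let dN (y : V) : 'M[R]_n := y.1.2.
Let dP (y : V) : 'M[R]_n := y.2.

(** The right-hand side must contain no term linear in the unknowns. In [Z = k X0 + k D + K0 D] the
    last term is such a term, so [D] is replaced there by its own equation [aX + qX]; the increments
    of [K^T Ri K X] and [K^T R2 K X] treat [K0^T Ri Z] and [K0^T R2 Z] likewise. *)
Let aX (k : 'M[R]_(m, n)) : 'M[R]_n := - Li (B *m k *m X0 + X0 *m k^T *m B^T +
  b *: (X0 *m k^T *m Ri *m K0 *m X0 + X0 *m K0^T *m Ri *m k *m X0)).
Let aZ k := k *m X0 + K0 *m aX k.
Let alin (k : 'M[R]_(m, n)) : V :=
  (k, aX k, aZ k, k^T *m Ri *m K0 *m X0 + K0^T *m Ri *m aZ k,
   k^T *m R2 *m K0 *m X0 + K0^T *m R2 *m aZ k).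

Let qX (y z : V) : 'M[R]_n := - Li (B *m dK y *m dX z + dX y *m (dK z)^T *m B^T +
  b *: (X0 *m K0^T *m Ri *m dK y *m dX z + X0 *m (dK y)^T *m Ri *m dZ z +
        dX y *m (Qi *m dX z + dN z))).
Let qZ y z := dK y *m dX z + K0 *m qX y z.
Let quad (y z : V) : V :=
  (0, qX y z, qZ y z, (dK y)^T *m Ri *m dZ z + K0^T *m Ri *m qZ y z,
   (dK y)^T *m R2 *m dZ z + K0^T *m R2 *m qZ y z).

Lemma quad_linr u : linear (quad u).
Proof. change (lin (quad u)); rewrite /quad /qZ /qX /dK /dX /dZ /dN; solve_lin. Qed.

Lemma quad_linl v : linear (quad^~ v).
Proof. change (lin (quad^~ v)); rewrite /quad /qZ /qX /dK /dX /dZ /dN; solve_lin. Qed.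

Lemma alin_lin : lin alin.
Proof. rewrite /alin /aZ /aX; solve_lin. Qed.

Lemma trmxD p q (M N : 'M[R]_(p, q)) : (M + N)^T = M^T + N^T.
Proof. exact: linearD. Qed.

Lemma quadratic_riccati k y : y = alin k + quad y y ->
  let K := K0 + k in let X := X0 + dX y in
  AK A B K *m X + X *m (AK A B K)^T + b *: (X *m SK Qi Ri K *m X) + Bw *m Bw^T = 0 /\
  \tr ((Q2 + K^T *m R2 *m K) *m X) =
    \tr ((Q2 + K0^T *m R2 *m K0) *m X0) + (\tr (Q2 *m dX y) + \tr (dP y)).
Proof.
have [pX0 [ric0 hF0]] := sol0; have /psdP[sX0 _] := pX0.
have sS0 : S0^T = S0 := SK_sym pQi pRi K0.
move: y => [[[[k1 D] Z] N] P] /= yE.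
have k1E : k1 = k by move/(congr1 dK): yE => /=; rewrite /dK /= => ->; rewrite addr0.
subst k1.
have DE : D = aX k + qX (k, D, Z, N, P) (k, D, Z, N, P) := congr1 dX yE.
have ZE' : Z = aZ k + qZ (k, D, Z, N, P) (k, D, Z, N, P) := congr1 dZ yE.
have ZE : Z = k *m X0 + k *m D + K0 *m D.
  by rewrite [LHS]ZE' /aZ {1}/qZ addrACA -[K0 *m _ + _]mulmxDr -DE.
have NE : N = k^T *m Ri *m K0 *m X0 + k^T *m Ri *m Z + K0^T *m Ri *m Z.
  rewrite {2}ZE' mulmxDr addrACA; exact (congr1 dN yE).
have PE : P = k^T *m R2 *m K0 *m X0 + k^T *m R2 *m Z + K0^T *m R2 *m Z.
  rewrite {2}ZE' mulmxDr addrACA; exact (congr1 dP yE).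
have KX : (K0 + k) *m (X0 + D) = K0 *m X0 + Z.
  by rewrite ZE !mulmxDl !mulmxDr; matrix_abelian.
split; last first.
  rewrite mulmxDl -!mulmxA KX /dX /dP /= -!mxtraceD; congr (\tr _).
  rewrite PE trmxD !mulmxDl !mulmxDr !mulmxA; matrix_abelian.
have SX : SK Qi Ri (K0 + k) *m (X0 + D) = S0 *m X0 + (Qi *m D + N).
  rewrite /SK mulmxDl -!mulmxA KX /S0 /SK NE trmxD !mulmxDl !mulmxDr !mulmxA.
  matrix_abelian.
have LD : sylvester_op F0 D = - (B *m k *m X0 + X0 *m k^T *m B^T +
  b *: (X0 *m k^T *m Ri *m K0 *m X0 + X0 *m K0^T *m Ri *m k *m X0) +
  (B *m k *m D + D *m k^T *m B^T +
  b *: (X0 *m K0^T *m Ri *m k *m D + X0 *m k^T *m Ri *m Z + D *m (Qi *m D + N)))).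
  by rewrite {1}DE /aX /qX -opprD -linearD linearN /= sylvester_opVK.
have FT : F0^T = A0^T + b *: (S0 *m X0).
  by rewrite /F0 linearD linearZ /= trmx_mul sX0 sS0.
rewrite /dX /= -mulmxA SX.
have AKE : AK A B (K0 + k) = A0 + B *m k by rewrite /A0 /AK mulmxDr addrA.
rewrite AKE.
move: LD; rewrite sylvester_opE FT /F0 => /eqP; rewrite -subr_eq0 opprK => /eqP LD.
have X0N : X0 *m N = X0 *m k^T *m Ri *m K0 *m X0 + X0 *m k^T *m Ri *m Z
   + (X0 *m K0^T *m Ri *m k *m X0 + X0 *m K0^T *m Ri *m k *m D + X0 *m K0^T *m Ri *m K0 *m D).
  rewrite NE [in X in _ + X]ZE !mulmxDr !mulmxA; matrix_abelian.
have X0S : X0 *m S0 *m D = X0 *m Qi *m D + X0 *m K0^T *m Ri *m K0 *m D.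
  by rewrite /S0 /SK mulmxDr mulmxDl !mulmxA.
have ric0' : A0 *m X0 + X0 *m A0^T + b *: (X0 *m S0 *m X0) + Bw *m Bw^T = 0 := ric0.
(* The zero on the right is written as the Riccati equation at [K0] plus the equation for [D]. *)
rewrite trmxD trmx_mul -[RHS]addr0 -{1}ric0' -LD.
move: X0S X0N; move: (A0) (S0) (b) => A1 S1 b1 X0S X0N.
rewrite !mulmxDl !mulmxDr -!scalemxAl -!scalemxAr !mulmxA X0S X0N.
matrix_abelian.
Qed.

Let J := ('I_m * 'I_n)%type.
Let entries (k : 'M[R]_(m, n)) (ij : J) : R := k ij.1 ij.2.

Lemma alin_entries k : \sum_(ij : J) entries k ij *: alin (delta_mx ij.1 ij.2) = alin k.
Proof.
have alin0 : alin 0 = 0 by have := alin_lin (-1) 0 0; rewrite scaler0 addr0 scaleN1r addNr.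
have alinD : {morph alin : x y / x + y}.
  by move=> x y; have := alin_lin 1 x y; rewrite !scale1r.
have alinZ c x : alin (c *: x) = c *: alin x.
  by have := alin_lin c x 0; rewrite alin0 !addr0.
rewrite {2}(matrix_sum_delta k) pair_bigA /= (big_morph alin alinD alin0).
by apply: eq_bigr => ij _; rewrite alinZ.
Qed.

Lemma local_riccati_branch : exists (r C : R) (f : seq J -> R) (X : 'M[R]_(m, n) -> 'M[R]_n),
  [/\ 0 < r, forall d, wsum d (fun w => `|f w|) * r ^+ d <= C * 2^-1 ^+ d,
   forall i j, exists D : R, forall K, `|K - K0| <= r ->
     `|(X K - X0) i j| <= D * `|K - K0| &
   forall K, `|K - K0| <= r ->
     AK A B K *m X K + X K *m (AK A B K)^T + b *: (X K *m SK Qi Ri K *m X K) + Bw *m Bw^T = 0 /\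
     (fun D => \sum_(d < D) wsum d (fun w => f w * mono (entries (K - K0)) w)) @ \oo -->
     (\tr ((Q2 + K^T *m R2 *m K) *m X K) : R)].
Proof.
have [r [y [g [r0 hy hg]]]] := quadratic_system_analytic
  (fun ij : J => alin (delta_mx ij.1 ij.2)) quad_linr quad_linl.
have entr K t : `|K - K0| <= t -> forall ij, `|entries (K - K0) ij| <= t.
  by move=> h ij; apply: le_trans (norm_entry_le _ _ _) h.
have linJ : lin (fun z : V => \tr (Q2 *m dX z) + \tr (dP z) : R^o).
  by rewrite /dX /dP; apply: lin_D; solve_lin.
pose fJ : {linear V -> R^o} := HB.pack (fun z : V => \tr (Q2 *m dX z) + \tr (dP z) : R^o)
  (GRing.isLinear.Build R V R^o *:%R _ linJ).
have [C [hC' cC' _]] := hg fJ.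
pose h (w : seq J) : R := fJ (g w).
have hC d : wsum d (fun w => `|h w|) * r ^+ d <= C * 2^-1 ^+ d := hC' d.
have cC k : (forall ij, `|k ij| <= r) ->
    (fun D => \sum_(d < D) wsum d (fun w => h w * mono k w)) @ \oo --> (fJ (y k) : R).
  exact: cC'.
pose J0 := \tr ((Q2 + K0^T *m R2 *m K0) *m X0).
(* The word series has no constant term; the cost at [K0] is placed on the empty word. *)
exists r, (C + `|J0|), (fun w => h w + if w is [::] then J0 else 0).
exists (fun K => X0 + dX (y (entries (K - K0)))); split=> //.
- move=> d; apply: le_trans (_ : (wsum d (fun w => `|h w|) +
      wsum d (fun w : seq J => if w is [::] then `|J0| else 0)) * r ^+ d <= _).
    apply: ler_wpM2r; first by rewrite exprn_ge0 // ltW.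
    rewrite -wsumD; apply: ler_wsum => w _; apply: le_trans (ler_normD _ _) _.
    by rewrite lerD2l; case: w => [|? ?]; rewrite ?normr0.
  rewrite !mulrDl; apply: lerD; first exact: hC.
  case: d => [|d]; first by rewrite /= !expr0 !mulr1.
  rewrite [wsum _ _](_ : _ = 0) ?mul0r ?mulr_ge0 ?exprn_ge0 //.
  by apply: etrans (wsum0 _ _ d.+1); apply: eq_wsum; case.
- move=> i j; have linX : lin (fun z : V => dX z i j : R^o) by rewrite /dX; solve_lin.
  pose fX : {linear V -> R^o} := HB.pack (fun z : V => dX z i j : R^o)
    (GRing.isLinear.Build R V R^o *:%R _ linX).
  have [D [_ _ hD]] := hg fX; exists D => K hK.
  by rewrite addrC addKr; apply: hD; [rewrite normr_ge0|apply: entr].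
move=> K hK; set k := K - K0; have yE := hy _ (entr _ _ hK).
rewrite alin_entries in yE.
have [ric trE] := quadratic_riccati yE; rewrite /k subrKC in ric trE.
split; first exact: ric.
rewrite trE -/J0 addrC.
have lim : (fun D => \sum_(d < D) wsum d (fun w => h w * mono (entries (K - K0)) w) + J0)
    @ \oo --> fJ (y (entries (K - K0))) + J0.
  by apply: cvgD; [apply: cC; apply: entr|apply: cvg_cst].
have E : \forall D \near \oo, \sum_(d < D) wsum d (fun w => h w * mono (entries (K - K0)) w) + J0 =
  \sum_(d < D) wsum d (fun w => (h w + (if w is [::] then J0 else 0)) * mono (entries (K - K0)) w).
  (* For [D = 0] the sum on the right is empty and misses [J0]. *)
  exists 1%N => // D /= D1.
  under [RHS]eq_bigr => d _.
    rewrite (_ : wsum d _ = wsum d (fun w => h w * mono (entries (K - K0)) w) +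
      wsum d (fun w : seq J => if w is [::] then J0 else 0)); last first.
      rewrite -wsumD; apply: eq_wsum => w _; rewrite mulrDl; congr (_ + _).
      by case: w => [|? ?]; rewrite ?mul0r // /mono big_nil mulr1.
    over.
  rewrite big_split /=; congr (_ + _); case: D D1 => // D _.
  rewrite big_ord_recl big1 ?addr0 // => i _.
  by apply: etrans (wsum0 _ _ i.+1); apply: eq_wsum; case.
apply: cvg_trans lim; exact: near_eq_cvg.
Qed.

End LocalSolution.

(** * The branch is the stabilizing solution *)

Section MainProof.
Variables (R : realType) (n m : nat).
Variables (A : 'M[R]_n) (B : 'M[R]_(n, m)) (Bw Qi : 'M[R]_n) (Ri : 'M[R]_m) (beta : R).
Hypotheses (pQi : pd Qi) (pRi : pd Ri) (beta0 : 0 < beta).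
Local Notation sol := (stab_riccati_sol A B Bw Qi Ri beta).

(** The series branch is known only to solve the equation, not to be symmetric. Its transpose solves
    the same equation, so uniqueness applies to the two. The form of [A_K X] is then minus half of
    two nonnegative terms, as Lyapunov's theorem requires. *)
Lemma stab_riccati_solI K X : hurwitz (AK A B K) ->
  AK A B K *m X + X *m (AK A B K)^T + beta ^- 2 *: (X *m SK Qi Ri K *m X) + Bw *m Bw^T = 0 ->
  hurwitz (AK A B K + beta ^- 2 *: (X *m SK Qi Ri K)) -> sol K X.
Proof.
move=> hA ric hF; have sS := SK_sym pQi pRi K.
have sX : X^T = X.
  apply/esym; apply: (riccati_stabilizing_unique sS ric _ hF); rewrite ?trmxK //.
  move: (AK A B K) (SK Qi Ri K) sS ric {hA hF} => A1 S1 sS ric.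
  have := congr1 trmx ric; rewrite trmx0 => <-.
  rewrite !trmxD !trmx_mul !trmxK [(_ *: _)^T]linearZ /= !trmx_mul sS !mulmxA.
  by rewrite [X^T *m _ + _]addrC.
split=> //; apply: (lyapunov_psd hA sX) => v.
have [c c0 hc] := SK_coercive pQi pRi.
have := riccati_form v sX ric; rewrite -mulmxA (dotv_tr Bw) -mulmxA (dotv_tr (AK A B K)).
have := le_trans (mulr_ge0 (ltW c0) (dotvv_ge0 (X *m v))) (hc K (X *m v)).
move=> /(mulr_ge0 (ltW (beta_inv_gt0 beta0))); have := dotvv_ge0 (Bw^T *m v).
lra.
Qed.

(** By contradiction: failing gains at distances below [1 / (k + 1)] form a sequence converging to
    [K0], along which the linear bound makes [X] converge to [X0]. *)
Lemma branch_hurwitz_near (X : 'M[R]_(m, n) -> 'M[R]_n) K0 X0 r : 0 < r ->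
  hurwitz (AK A B K0 + beta ^- 2 *: (X0 *m SK Qi Ri K0)) ->
  (forall i j, exists D : R, forall K, `|K - K0| <= r -> `|(X K - X0) i j| <= D * `|K - K0|) ->
  exists2 e, 0 < e & forall K, `|K - K0| < e ->
    hurwitz (AK A B K + beta ^- 2 *: (X K *m SK Qi Ri K)).
Proof.
move=> r0 hF0 hX; apply: contrapT => no.
have [K hK] : exists K : nat -> 'M[R]_(m, n), forall k, `|K k - K0| < Num.min r k.+1%:R^-1 /\
    ~ hurwitz (AK A B (K k) + beta ^- 2 *: (X (K k) *m SK Qi Ri (K k))).
  suff h k : exists K, `|K - K0| < Num.min r k.+1%:R^-1 /\
      ~ hurwitz (AK A B K + beta ^- 2 *: (X K *m SK Qi Ri K)).
    by have [K hK] := choice h; exists K.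
  apply: contrapT => nok; apply: no; exists (Num.min r k.+1%:R^-1).
    by rewrite lt_min r0 invr_gt0 ltr0Sn.
  move=> K hK; apply: contrapT => nF; apply: nok; exists K; split; [exact: hK|exact: nF].
have KK0 : mcvg K K0.
  by apply: mcvg_of_dist => k; have [h _] := hK k; move: h; rewrite lt_min => /andP[].
have Kr k : `|K k - K0| <= r.
  by have [h _] := hK k; move: h; rewrite lt_min => /andP[/ltW].
have XX0 : mcvg (fun k => X (K k)) X0.
  move=> i j; have [D hD] := hX i j.
  have d0 : (fun k => (X (K k) - X0) i j) @ \oo --> (0 : R).
    apply/cvgr0Pnorm_le => e e0.
    have : (fun k => `|D| * harmonic k) @ \oo --> (0 : R).
      by rewrite -[0](mulr0 `|D|); apply: cvgMr; apply: cvg_harmonic.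
    move=> /cvgr0Pnorm_le/(_ e e0); apply: filterS => k /=; apply: le_trans.
    apply: le_trans (hD _ (Kr k)) _; rewrite normrM normr_id.
    apply: le_trans (_ : `|D| * `|K k - K0| <= _).
      by rewrite ler_wpM2r // ler_norm.
    apply: ler_wpM2l => //; apply: le_trans (ler_norm _).
    by have [h _] := hK k; move: h; rewrite lt_min => /andP[_ /ltW].
  have : (fun k => (X (K k) - X0) i j + X0 i j) @ \oo --> 0 + X0 i j.
    by apply: cvgD => //; apply: cvg_cst.
  by rewrite add0r; under eq_fun do rewrite !mxE subrK.
have /(hurwitz_near hF0)[N _ hN] := mcvgD (mcvg_AK (A := A) (B := B) KK0)
  (mcvgZ (beta ^- 2) (mcvgM XX0 (mcvg_SK (Qi := Qi) (Ri := Ri) KK0))).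
by have [_] := hK N; apply; apply: hN => /=.
Qed.

End MainProof.

Theorem theorem2 (R : realType) (n m : nat)
    (A : 'M[R]_n) (B : 'M[R]_(n, m)) (Bw : 'M[R]_n)
    (Q2 : 'M[R]_n) (R2 : 'M[R]_m) (Qi : 'M[R]_n) (Ri : 'M[R]_m) (beta : R) :
  psd Q2 -> pd R2 -> pd Qi -> pd Ri -> 0 < beta ->
  (* Assumption 1 *)
  stabilizable A B ->
  detectable (sqrtm Q2) A ->
  inf [set hinf_norm A B Bw Qi Ri K | K in Kstab A B] < beta ->
  real_analytic_on (Kbeta A B Bw Qi Ri beta) (Jmix A B Bw Q2 R2 Qi Ri beta).
Proof.
move=> _ _ pQi pRi beta0 _ _ _ K0 K0b.
have [[r [r0 nosol]]|sols] := pselect (exists r : R, 0 < r /\ forall K,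
    Kbeta A B Bw Qi Ri beta K -> `|K - K0| < r ->
    ~ exists X, stab_riccati_sol A B Bw Qi Ri beta K X).
  exists r; split=> //; exists (fun=> 0) => K Kb Kr; split.
    exists 0 => N; rewrite /pabssum big1 // => a _; by rewrite mul0r normr0.
  rewrite /Jmix (XK_eq0 (nosol K Kb Kr)) mulmx0 mxtrace0.
  have -> : psum (fun=> 0) K0 K = (fun=> 0).
    by apply: funext => N; rewrite /psum big1 // => a _; rewrite mul0r.
  exact: cvg_cst.
have [X0 sol0] : exists X0, stab_riccati_sol A B Bw Qi Ri beta K0 X0.
  (* Without a solution-free neighbourhood, every scale [1 / (k + 1)] has a gain with a stabilizing
     solution. *)
  have approx k : exists KX : 'M[R]_(m, n) * 'M[R]_n, `|KX.1 - K0| < k.+1%:R^-1 /\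
      stab_riccati_sol A B Bw Qi Ri beta KX.1 KX.2.
    apply: contrapT => no; apply: sols; exists k.+1%:R^-1; split.
      by rewrite invr_gt0 ltr0Sn.
    by move=> K _ Kk [X hX]; apply: no; exists (K, X).
  have [KX hKX] := choice approx.
  apply: (stab_riccati_sol_closed pQi pRi beta0 (K := fun k => (KX k).1)
    (X := fun k => (KX k).2) K0b).
    by apply: mcvg_of_dist => k; have [] := hKX k.
  by move=> k; have [] := hKX k.
have [_ [_ hF0]] := sol0.
have [r [C [f [X [r0 fC XX0 hX]]]]] := local_riccati_branch Q2 R2 pQi pRi sol0.
have [e e0 hF] := branch_hurwitz_near r0 hF0 XX0.
(* Within [r] the series converges to the cost of the branch; within [e] the branch is stabilizing,
   hence equal to [XK]. *)
exists (Num.min r e); split; first by rewrite lt_min r0.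
exists (monomial_coef f) => K [hA _]; rewrite lt_min => /andP[/ltW Kr Ke].
have [ric lim] := hX K Kr; split.
  by exists (2 * C) => N; apply: (pabssum_le r0 fC Kr).
have solK := stab_riccati_solI pQi pRi beta0 hA ric (hF K Ke).
by rewrite /Jmix (XK_eq pQi pRi solK); apply: (psum_cvg r0 fC Kr lim).
Qed.
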